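(* Let $\mathcal{H}=(H,\cdot,\mathbin{:})$ be a Hopf $q$-brace over a field $k$, with $S$ the antipode of $H$, and let $(H,s)$ be the weak braiding operator associated with $\mathcal{H}$. Then $s$ is bijective, and the square with top arrow $\tilde s_\tau^{-1}\colon H^{\mathrm{op\,cop}}\otimes H^{\mathrm{op\,cop}}\to H^{\mathrm{op\,cop}}\otimes H^{\mathrm{op\,cop}}$, bottom arrow $s\colon H\otimes H\to H\otimes H$ and both vertical arrows $S\otimes S\colon H^{\mathrm{op\,cop}}\otimes H^{\mathrm{op\,cop}}\to H\otimes H$ is a commutative diagram of coalgebra morphisms; that is, $(S\otimes S)\circ\tilde s_\tau^{-1}=s\circ(S\otimes S)$.
   Context: All vector spaces, maps and tensor products are over $k$ (maps are linear); Sweedler notation is used; $\epsilon$ is the counit; $\mathrm{op}$ and $\mathrm{cop}$ denote opposite algebra and opposite coalgebra; $\tau$ is the flip. $\tilde s_\tau$ is the map $\tau\circ s\circ\tau$ regarded as an endomorphism of the tensor square of the opposite coalgebra. Multiplication in $H$ binds tighter than $\cdot$ and $\mathbin{:}$. Hopf $q$-brace: a triple $(H,\cdot,\mathbin{:})$, $H$ a Hopf algebra, with linear maps $\cdot,\mathbin{:}\colon H\otimes H\to H$ satisfying $\epsilon(x\cdot y)=\epsilon(x\mathbin{:}y)=\epsilon(x)\epsilon(y)$ such that: $H\otimes H^{\mathrm{cop}}\to H^{\mathrm{cop}}\otimes H$, $x\otimes y\mapsto y_{(1)}\mathbin{:}x_{(2)}\otimes x_{(1)}\cdot y_{(2)}$,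 is a coalgebra morphism; $\overline G\colon x\otimes y\mapsto x\cdot y_{(1)}\otimes y_{(2)}$ is invertible; for all $x,y,z$: $(x\cdot y_{(1)})\cdot(z\mathbin{:}y_{(2)})=(x\cdot z_{(2)})\cdot(y\cdot z_{(1)})$, $(x\cdot y_{(1)})\mathbin{:}(z\cdot y_{(2)})=(x\mathbin{:}z_{(2)})\cdot(y\mathbin{:}z_{(1)})$, $(x\mathbin{:}y_{(1)})\mathbin{:}(z\mathbin{:}y_{(2)})=(x\mathbin{:}z_{(2)})\mathbin{:}(y\cdot z_{(1)})$; $H$ is a right $H^{\mathrm{op}}$-module via $\cdot$ and via $\mathbin{:}$ ($h\cdot1=h$, $h\cdot ml=(h\cdot l)\cdot m$ and likewise for $\mathbin{:}$); and $hm\cdot l=(h\cdot(l_{(1)}\mathbin{:}m_{(2)}))(m_{(1)}\cdot l_{(2)})$, $hm\mathbin{:}l=(h\mathbin{:}(l_{(1)}\cdot m_{(2)}))(m_{(1)}\mathbin{:}l_{(2)})$ for all $h,m,l\in H$. The weak braiding operator associated with $\mathcal H$ is $(H,s)$ with $s(x\otimes y):={}^{x_{(2)}}y_{(2)}\otimes{x_{(1)}}^{y_{(1)}}$, where $x^y:=(\mathrm{id}\otimes\epsilon)\overline G^{-1}(x\otimes y)$ and ${}^xy:=y_{(2)}\mathbin{:}x^{y_{(1)}}$; $s$ is a coalgebra endomorphism of $H\otimes H$. *)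

(* Defs.v *)
From HB Require Import structures.
From mathcomp Require Import all_boot all_algebra.
From mathcomp Require Import boolp.

Set Implicit Arguments.
Unset Strict Implicit.
Unset Printing Implicit Defensive.

Import GRing.Theory.
Local Open Scope ring_scope.

Reserved Notation "U \ox V" (at level 40, left associativity).
Reserved Notation "C ^cop" (at level 2, format "C ^cop").
Reserved Notation "\sw_ ( x1 , x2 <- x ) E"
  (at level 41, E at level 41, x1 name, x2 name, x at level 60,
   format "'[' \sw_ ( x1 ,  x2  <-  x ) '/  '  E ']'").

(* Tensor product of two vector spaces by generators and relations: a tensor  *)
(* is a class of formal sums [:: (u_1, v_1); ...; (u_n, v_n)].  No formal     *)
(* opposites are needed, since [:: (u, v); (- u, v)] is equivalent to [::].   *)
(* The universal property is given by tlift_linear, tliftE and tensor_ext.    *)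

Section Tensor.
Variables (k : fieldType) (U V : lmodType k).

Inductive tens_eqv : seq (U * V) -> seq (U * V) -> Prop :=
| tens_refl s : tens_eqv s s
| tens_sym s t : tens_eqv s t -> tens_eqv t s
| tens_trans s t r : tens_eqv s t -> tens_eqv t r -> tens_eqv s r
| tens_cat s t s' t' :
    tens_eqv s t -> tens_eqv s' t' -> tens_eqv (s ++ s') (t ++ t')
| tens_comm s t : tens_eqv (s ++ t) (t ++ s)
| tens_addl u u' v : tens_eqv [:: (u + u', v)] [:: (u, v); (u', v)]
| tens_addr u v v' : tens_eqv [:: (u, v + v')] [:: (u, v); (u, v')]
| tens_scale a u v : tens_eqv [:: (a *: u, v)] [:: (u, a *: v)]
| tens_zero v : tens_eqv [:: (0, v)] [::].

Definition tens_rel : rel (seq (U * V)) := fun s t => `[< tens_eqv s t >].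

Fact tens_rel_refl : reflexive tens_rel.
Proof. by move=> s; apply/asboolP; apply: tens_refl. Qed.

Fact tens_rel_sym : symmetric tens_rel.
Proof. by move=> s t; apply/asboolP/asboolP; apply: tens_sym. Qed.

Fact tens_rel_trans : transitive tens_rel.
Proof. by move=> t s r /asboolP st /asboolP tr; apply/asboolP/(tens_trans st). Qed.

Canonical tens_equiv := EquivRel tens_rel
  tens_rel_refl tens_rel_sym tens_rel_trans.

Definition tensor : Type := {eq_quot tens_rel}%qT.
HB.instance Definition _ := Choice.copy tensor {eq_quot tens_rel}%qT.

Definition tens_of (s : seq (U * V)) : tensor := (\pi_({eq_quot tens_rel}) s)%qT.
Definition tens_repr (t : tensor) : seq (U * V) :=
  (repr (t : {eq_quot tens_rel}))%qT.

Lemma tens_reprK t : tens_of (tens_repr t) = t.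
Proof. exact: reprK. Qed.

Lemma tens_ofP s t : tens_of s = tens_of t <-> tens_eqv s t.
Proof.
split; first by move/eqmodP/asboolP.
by move=> st; apply/eqmodP/asboolP.
Qed.

Lemma tens_of_repr s : tens_eqv (tens_repr (tens_of s)) s.
Proof. by apply/tens_ofP; rewrite tens_reprK. Qed.

Definition zscale (a : k) (s : seq (U * V)) : seq (U * V) :=
  [seq (a *: p.1, p.2) | p <- s].

Lemma zscale_eqv a s t : tens_eqv s t -> tens_eqv (zscale a s) (zscale a t).
Proof.
elim=> {s t} //=.
- by move=> s; apply: tens_refl.
- by move=> s t _; apply: tens_sym.
- by move=> s t r _ ? _; apply: tens_trans.
- by move=> s t s' t' _ ? _ ?; rewrite /zscale !map_cat; apply: tens_cat.
- by move=> s t; rewrite /zscale !map_cat; apply: tens_comm.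
- by move=> u u' v; rewrite scalerDr; apply: tens_addl.
- by move=> u v v'; apply: tens_addr.
- by move=> b u v; rewrite scalerA mulrC -scalerA; apply: tens_scale.
- by move=> v; rewrite scaler0; apply: tens_zero.
Qed.

Definition tadd (s t : tensor) : tensor := tens_of (tens_repr s ++ tens_repr t).
Definition tscale (a : k) (t : tensor) : tensor := tens_of (zscale a (tens_repr t)).
Definition topp (t : tensor) : tensor := tscale (-1) t.

Lemma tadd_of s t : tadd (tens_of s) (tens_of t) = tens_of (s ++ t).
Proof. by apply/tens_ofP/tens_cat; apply: tens_of_repr. Qed.

Lemma tscale_of a s : tscale a (tens_of s) = tens_of (zscale a s).
Proof. by apply/tens_ofP/zscale_eqv/tens_of_repr. Qed.

Lemma tens_cons_mid p s t : tens_eqv (s ++ p :: t) (p :: (s ++ t)).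
Proof.
rewrite -[p :: t]cat1s -[p :: (s ++ t)]cat1s !catA.
exact: tens_cat (tens_comm s [:: p]) (tens_refl t).
Qed.

Fact taddA : associative tadd.
Proof.
move=> s t r; rewrite -[s]tens_reprK -[t]tens_reprK -[r]tens_reprK.
by rewrite !tadd_of catA.
Qed.

Fact taddC : commutative tadd.
Proof. by move=> s t; apply/tens_ofP/tens_comm. Qed.

Fact tadd0 : left_id (tens_of [::]) tadd.
Proof. by move=> t; rewrite -[t]tens_reprK tadd_of. Qed.

Fact taddN : left_inverse (tens_of [::]) topp tadd.
Proof.
move=> t; rewrite -[t]tens_reprK /topp tscale_of tadd_of; apply/tens_ofP.
elim: (tens_repr t) => [|[u v] s IHs]; first exact: tens_refl.
have E1 : tens_eqv (zscale (-1) ((u, v) :: s) ++ (u, v) :: s)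
    ([:: (-1 *: u, v); (u, v)] ++ (zscale (-1) s ++ s)).
  apply: (tens_cat (tens_refl [:: (-1 *: u, v)])).
  exact: tens_cons_mid.
apply: tens_trans E1 _; rewrite -[[::]]/([::] ++ [::]); apply: tens_cat IHs.
apply: tens_trans (tens_sym (tens_addl _ _ _)) _.
by rewrite scaleN1r addNr; apply: tens_zero.
Qed.

HB.instance Definition _ := GRing.isZmodule.Build tensor taddA taddC tadd0 taddN.

Lemma tens_ofD s t : tens_of s + tens_of t = tens_of (s ++ t).
Proof. exact: tadd_of. Qed.

Fact tscaleA a b t : tscale a (tscale b t) = tscale (a * b) t.
Proof.
rewrite -[t]tens_reprK !tscale_of /zscale -map_comp; congr tens_of.
by apply: eq_map => p /=; rewrite scalerA.
Qed.

Fact tscale1 : left_id 1 tscale.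
Proof.
move=> t; rewrite -[RHS]tens_reprK; congr tens_of.
by rewrite /zscale map_id_in // => -[u v] _; rewrite scale1r.
Qed.

Fact tscaleDr : right_distributive tscale +%R.
Proof.
move=> a s t; rewrite -[s]tens_reprK -[t]tens_reprK tens_ofD !tscale_of tens_ofD.
by rewrite /zscale map_cat.
Qed.

Fact tscaleDl t : {morph tscale^~ t : a b / a + b}.
Proof.
move=> a b; rewrite -[t]tens_reprK /= !tscale_of tens_ofD; apply/tens_ofP.
elim: (tens_repr t) => [|[u v] s IHs]; first exact: tens_refl.
rewrite /= scalerDl.
apply: tens_trans (tens_cat (tens_addl _ _ _) IHs) _.
apply: (tens_cat (tens_refl [:: (a *: u, v)])).
exact: tens_sym (tens_cons_mid _ _ _).
Qed.

HB.instance Definition _ :=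
  GRing.Zmodule_isLmodule.Build k tensor tscaleA tscale1 tscaleDr tscaleDl.

Lemma tens_ofZ a s : a *: tens_of s = tens_of (zscale a s).
Proof. exact: tscale_of. Qed.

Definition tens (u : U) (v : V) : tensor := tens_of [:: (u, v)].

End Tensor.

Arguments tensor {k} (U V)%_type_scope.

Notation "U \ox V" := (tensor U V) : type_scope.
Notation "u \ox v" := (tens u v) : ring_scope.

Section LinearFun.
Variables (k : fieldType) (V W : lmodType k) (g : V -> W).
Hypothesis g_lin : linear g.

Lemma lin_zero : g 0 = 0.
Proof. by have := g_lin (-1) 0 0; rewrite scaler0 addr0 scaleN1r addNr. Qed.

Lemma lin_add : {morph g : x y / x + y}.
Proof. by move=> x y; have := g_lin 1 x y; rewrite !scale1r. Qed.

Lemma lin_scale : scalable g.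
Proof. by move=> a x; have := g_lin a x 0; rewrite lin_zero !addr0. Qed.

End LinearFun.

Section Lift.
Variables (k : fieldType) (U V : lmodType k).

Definition bilin (W : lmodType k) (f : U -> V -> W) : Prop :=
  (forall v, linear (f^~ v)) /\ (forall u, linear (f u)).

Lemma tens_bilin : bilin (@tens k U V).
Proof.
split=> [v a u u'|u a v v'].
  by rewrite tens_ofZ tens_ofD; apply/tens_ofP; apply: tens_addl.
rewrite tens_ofZ tens_ofD; apply/tens_ofP.
apply: tens_trans (tens_addr _ _ _) _.
exact: tens_cat (tens_sym (tens_scale a u v)) (tens_refl [:: (u, v')]).
Qed.

(* tlift f maps sum_i u_i (x) v_i to sum_i f u_i v_i.  It is a total function *)
(* of f, but depends on the chosen representative unless f is bilinear.       *)
Definition tlift (W : lmodType k) (f : U -> V -> W) (t : U \ox V) : W :=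
  \sum_(p <- tens_repr t) f p.1 p.2.

Lemma tensE (t : U \ox V) : t = tlift (fun u v => u \ox v) t.
Proof.
rewrite -[LHS]tens_reprK /tlift.
elim: (tens_repr t) => [|[u v] s IHs]; first by rewrite big_nil.
by rewrite big_cons -IHs /= tens_ofD.
Qed.

Lemma tlift_of (W : lmodType k) (f : U -> V -> W) (s : seq (U * V)) :
  bilin f -> tlift f (tens_of s) = \sum_(p <- s) f p.1 p.2.
Proof.
case=> fl fr; rewrite /tlift.
have := tens_of_repr s; move: (tens_repr _) => t.
elim=> {s t} //=.
- by move=> s t r _ -> _ ->.
- by move=> s t s' t' _ E _ E'; rewrite !big_cat /= E E'.
- by move=> s t; rewrite !big_cat /= addrC.
- by move=> u u' v; rewrite !big_cons !big_nil /= !addr0 (lin_add (fl v)).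
- by move=> u v v'; rewrite !big_cons !big_nil /= !addr0 (lin_add (fr u)).
- by move=> a u v; rewrite !big_cons !big_nil /= (lin_scale (fl v)) (lin_scale (fr u)).
- by move=> v; rewrite !big_cons !big_nil /= (lin_zero (fl v)) addr0.
Qed.

Lemma tliftE (W : lmodType k) (f : U -> V -> W) (u : U) (v : V) :
  bilin f -> tlift f (u \ox v) = f u v.
Proof. by move=> fb; rewrite tlift_of // big_seq1. Qed.

Lemma tlift_linear (W : lmodType k) (f : U -> V -> W) :
  bilin f -> linear (tlift f).
Proof.
move=> fb a s t; rewrite -[s]tens_reprK -[t]tens_reprK.
rewrite tens_ofZ tens_ofD !tlift_of // big_cat big_map /= scaler_sumr.
congr (_ + _); apply: eq_bigr => p _ /=.
exact: lin_scale (fb.1 p.2) _ _.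
Qed.

Lemma linear_tlift (W W' : lmodType k) (g : W -> W') (f : U -> V -> W)
    (t : U \ox V) :
  linear g -> g (tlift f t) = tlift (fun u v => g (f u v)) t.
Proof. by move=> gl; rewrite /tlift (big_morph g (lin_add gl) (lin_zero gl)). Qed.

Lemma tensor_ext (W : lmodType k) (f g : U \ox V -> W) :
  linear f -> linear g ->
  (forall u v, f (u \ox v) = g (u \ox v)) -> forall t, f t = g t.
Proof.
move=> fl gl fg t; rewrite [t]tensE !(linear_tlift _ _ fl) (linear_tlift _ _ gl).
by apply: eq_bigr => p _.
Qed.

Lemma eq_tlift (W : lmodType k) (f g : U -> V -> W) :
  (forall u v, f u v = g u v) -> forall t, tlift f t = tlift g t.
Proof. by move=> fg t; apply: eq_bigr => p _; apply: fg. Qed.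

End Lift.

Definition tmap (k : fieldType) (U V U' V' : lmodType k)
  (f : U -> U') (g : V -> V') : U \ox V -> U' \ox V' :=
  tlift (fun u v => f u \ox g v).

Definition tswap (k : fieldType) (U V : lmodType k) : U \ox V -> V \ox U :=
  tlift (fun u v => v \ox u).

Section LinearClosure.
Variables (k : fieldType) (X U V W : lmodType k).

Lemma linear_comp (g : U -> V) (f : X -> U) :
  linear g -> linear f -> linear (fun x => g (f x)).
Proof. by move=> gl fl a x y; rewrite fl gl. Qed.

Lemma linear_tensl (f : X -> U) (v : V) :
  linear f -> linear (fun x => f x \ox v).
Proof. by move=> fl a x y; rewrite fl ((tens_bilin U V).1 v). Qed.

Lemma linear_tensr (u : U) (f : X -> V) :
  linear f -> linear (fun x => u \ox f x).
Proof. by move=> fl a x y; rewrite fl ((tens_bilin U V).2 u). Qed.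

Lemma linear_tlift_arg (F : U -> V -> W) (f : X -> U \ox V) :
  bilin F -> linear f -> linear (fun x => tlift F (f x)).
Proof. by move=> /tlift_linear Fl fl a x y; rewrite fl Fl. Qed.

Lemma linear_tlift_fun (F : X -> U -> V -> W) (t : U \ox V) :
  (forall u v, linear (fun x => F x u v)) -> linear (fun x => tlift (F x) t).
Proof.
move=> Fl a x y; rewrite /tlift scaler_sumr -big_split /=.
by apply: eq_bigr => p _; apply: Fl.
Qed.

End LinearClosure.

Lemma exchange_tlift (k : fieldType) (U V U' V' W : lmodType k)
    (F : U -> V -> U' -> V' -> W) (t : U \ox V) (t' : U' \ox V') :
  tlift (fun u v => tlift (fun u' v' => F u v u' v') t') t =
  tlift (fun u' v' => tlift (fun u v => F u v u' v') t) t'.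
Proof. exact: exchange_big. Qed.

HB.mixin Record isCoalgebra (k : fieldType) C of GRing.Lmodule k C := {
  comul : C -> C \ox C;
  comul_linear : linear comul;
  counit : C -> k;
  counit_scalar : scalar counit;
  comulA : forall x,
    tlift (fun x1 x2 =>
      tlift (fun x11 x12 => (x11 \ox x12) \ox x2) (comul x1)) (comul x) =
    tlift (fun x1 x2 =>
      tlift (fun x21 x22 => (x1 \ox x21) \ox x22) (comul x2)) (comul x);
  counitl : forall x, tlift (fun x1 x2 => counit x1 *: x2) (comul x) = x;
  counitr : forall x, tlift (fun x1 x2 => counit x2 *: x1) (comul x) = x;
}.

#[short(type="coalgType")]
HB.structure Definition Coalgebra (k : fieldType) :=
  { C of GRing.Lmodule k C & isCoalgebra k C }.

Notation "\sw_ ( x1 , x2 <- x ) E" := (tlift (fun x1 x2 => E) (comul x))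
  : ring_scope.

Definition coalg_morphism (k : fieldType) (C D : coalgType k) (f : C -> D) :
    Prop :=
  [/\ linear f,
      forall x, counit (f x) = counit x
    & forall x, comul (f x) = tmap f f (comul x)].

Section CoalgebraTheory.
Variables (k : fieldType) (C : coalgType k).

Lemma linear_counitl (V : lmodType k) (v : V) :
  linear (fun x : C => counit x *: v).
Proof. by move=> a x y; rewrite counit_scalar scalerDl scalerA. Qed.

Lemma sweedlerA (W : lmodType k) (F : C -> C -> C -> W) (x : C) :
  (forall b c, linear (fun a => F a b c)) ->
  (forall a c, linear (fun b => F a b c)) ->
  (forall a b, linear (fun c => F a b c)) ->
  \sw_(x1, x2 <- x) \sw_(x11, x12 <- x1) F x11 x12 x2 =
  \sw_(x1, x2 <- x) \sw_(x21, x22 <- x2) F x1 x21 x22.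
Proof.
move=> F1 F2 F3.
pose G := fun (t : C \ox C) (c : C) => tlift (fun a b => F a b c) t.
have Fb c : bilin (fun a b => F a b c) by split=> ?; [apply: F1|apply: F2].
have Gb : bilin G.
  split=> [c|t]; first exact: tlift_linear.
  by apply: linear_tlift_fun => a b; apply: F3.
have Gl := tlift_linear Gb.
have GE a b c : tlift G ((a \ox b) \ox c) = F a b c.
  by rewrite tliftE // /G tliftE.
have /(congr1 (tlift G)) := comulA x; rewrite !(linear_tlift _ _ Gl) => E.
transitivity (\sw_(a, b <- x) tlift G (\sw_(c, d <- a) (c \ox d) \ox b)).
  by apply: eq_tlift => a b; rewrite (linear_tlift _ _ Gl); apply: eq_tlift.
rewrite E; apply: eq_tlift => a b.
by rewrite (linear_tlift _ _ Gl); apply: eq_tlift.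
Qed.

End CoalgebraTheory.

Lemma linear_idfun (k : fieldType) (V : lmodType k) : linear (fun x : V => x).
Proof. by []. Qed.

Lemma linear_counit_scale (k : fieldType) (C : coalgType k) (X V : lmodType k)
    (f : X -> C) (v : V) :
  linear f -> linear (fun x => counit (f x) *: v).
Proof. by move=> fl a x y; rewrite fl counit_scalar scalerDl scalerA. Qed.

Lemma linear_scale_fun (k : fieldType) (X V : lmodType k) (a : k) (f : X -> V) :
  linear f -> linear (fun x => a *: f x).
Proof.
by move=> fl b x y; rewrite fl scalerDr !scalerA mulrC.
Qed.

Ltac lin := repeat
  first [ lazymatch goal with
          | |- forall _, _ => intro
          | |- bilin _ => split
          end
        | exact: linear_idfun
        | exact: comul_linear
        | apply: linear_counit_scale
        | apply: linear_scale_fun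
        | apply: linear_tensl
        | apply: linear_tensr
        | apply: linear_tlift_fun
        | apply: linear_tlift_arg ].

Lemma tlift_swap (k : fieldType) (U V W : lmodType k) (F : V -> U -> W)
    (t : U \ox V) :
  bilin F -> tlift F (tswap t) = tlift (fun u v => F v u) t.
Proof.
move=> Fb; rewrite (linear_tlift _ _ (tlift_linear Fb)).
by apply: eq_tlift => u v; rewrite tliftE.
Qed.

Lemma tswap_linear (k : fieldType) (U V : lmodType k) : linear (@tswap k U V).
Proof. by apply: tlift_linear; lin. Qed.

(* Co-opposite coalgebra; it is also the coalgebra underlying H^{op cop}, the *)
(* multiplication of which plays no role for coalgebra morphisms.             *)
Definition cop (C : Type) : Type := C.
Notation "C ^cop" := (cop C) : type_scope.

Section Cop.
Variables (k : fieldType) (C : coalgType k).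

Definition cop_comul (x : C) : C \ox C := tswap (comul x).

Fact cop_comul_linear : linear cop_comul.
Proof. by move=> a x y; rewrite /cop_comul comul_linear tswap_linear. Qed.

Lemma tlift_cop (W : lmodType k) (F : C -> C -> W) (x : C) :
  bilin F -> tlift F (cop_comul x) = \sw_(x1, x2 <- x) F x2 x1.
Proof. exact: tlift_swap. Qed.

Fact cop_comulA (x : C) :
  tlift (fun x1 x2 =>
    tlift (fun x11 x12 => (x11 \ox x12) \ox x2) (cop_comul x1)) (cop_comul x) =
  tlift (fun x1 x2 =>
    tlift (fun x21 x22 => (x1 \ox x21) \ox x22) (cop_comul x2)) (cop_comul x).
Proof.
rewrite !tlift_cop; [|by lin..].
transitivity (\sw_(a, b <- x) \sw_(b1, b2 <- b) (b2 \ox b1) \ox a).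
  by apply: eq_tlift => a b; rewrite tlift_cop //; lin.
rewrite -(sweedlerA (F := fun a b c => (c \ox b) \ox a)); [|by lin..].
by apply: eq_tlift => a b; rewrite tlift_cop //; lin.
Qed.

Fact cop_counitl (x : C) :
  tlift (fun x1 x2 => counit x1 *: x2) (cop_comul x) = x.
Proof. by rewrite tlift_cop; [exact: counitr|lin]. Qed.

Fact cop_counitr (x : C) :
  tlift (fun x1 x2 => counit x2 *: x1) (cop_comul x) = x.
Proof. by rewrite tlift_cop; [exact: counitl|lin]. Qed.

HB.instance Definition _ := GRing.Lmodule.copy C^cop C.
HB.instance Definition _ := isCoalgebra.Build k C^cop
  cop_comul_linear (@counit_scalar k C) cop_comulA cop_counitl cop_counitr.

End Cop.

Section TensorCoalgebra.
Variables (k : fieldType) (C D : coalgType k).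

Definition tens_comul : C \ox D -> (C \ox D) \ox (C \ox D) :=
  tlift (fun c d =>
    \sw_(c1, c2 <- c) \sw_(d1, d2 <- d) (c1 \ox d1) \ox (c2 \ox d2)).

Definition tens_counit : C \ox D -> k :=
  tlift (W := k^o) (fun (c : C) (d : D) => counit c * counit d).

Lemma tens_comul_bilin : bilin (fun (c : C) (d : D) =>
  \sw_(c1, c2 <- c) \sw_(d1, d2 <- d) (c1 \ox d1) \ox (c2 \ox d2)).
Proof. by lin. Qed.

Fact tens_comul_linear : linear tens_comul.
Proof. exact: tlift_linear tens_comul_bilin. Qed.

Lemma tens_counit_bilin :
  bilin (W := k^o) (fun (c : C) (d : D) => counit c * counit d).
Proof.
split=> [d|c] a x y; first by rewrite counit_scalar mulrDl -mulrA.
by rewrite counit_scalar mulrDr mulrCA.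
Qed.

Fact tens_counit_scalar : scalar tens_counit.
Proof. exact: tlift_linear tens_counit_bilin. Qed.

Lemma tens_comulE c d : tens_comul (c \ox d) =
  \sw_(c1, c2 <- c) \sw_(d1, d2 <- d) (c1 \ox d1) \ox (c2 \ox d2).
Proof. exact: tliftE tens_comul_bilin. Qed.

Lemma tens_counitE c d : tens_counit (c \ox d) = counit c * counit d.
Proof. exact: tliftE tens_counit_bilin. Qed.

Lemma linear_tens_counit_scale (X V : lmodType k) (f : X -> C \ox D) (v : V) :
  linear f -> linear (fun x => tens_counit (f x) *: v).
Proof. by move=> fl a x y; rewrite fl tens_counit_scalar scalerDl scalerA. Qed.

Lemma tlift_tens_comul (W : lmodType k) (F : C \ox D -> C \ox D -> W) c d :
  bilin F -> tlift F (tens_comul (c \ox d)) =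
  \sw_(c1, c2 <- c) \sw_(d1, d2 <- d) F (c1 \ox d1) (c2 \ox d2).
Proof.
move=> Fb; have Fl := tlift_linear Fb.
rewrite tens_comulE (linear_tlift _ _ Fl); apply: eq_tlift => c1 c2.
by rewrite (linear_tlift _ _ Fl); apply: eq_tlift => d1 d2; rewrite tliftE.
Qed.

Ltac tlin := repeat
  first [ exact: tens_comul_linear
        | apply: linear_tens_counit_scale
        | progress lin ].

Fact tens_comulA (x : C \ox D) :
  tlift (fun x1 x2 =>
    tlift (fun x11 x12 => (x11 \ox x12) \ox x2) (tens_comul x1))
    (tens_comul x) =
  tlift (fun x1 x2 =>
    tlift (fun x21 x22 => (x1 \ox x21) \ox x22) (tens_comul x2))
    (tens_comul x).
Proof.
move: x; apply: tensor_ext; [by tlin|by tlin|move=> c d].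
rewrite !tlift_tens_comul; [|by tlin..].
transitivity (\sw_(c1, c2 <- c) \sw_(c11, c12 <- c1)
    \sw_(d1, d2 <- d) \sw_(d11, d12 <- d1)
    ((c11 \ox d11) \ox (c12 \ox d12)) \ox (c2 \ox d2)).
  apply: eq_tlift => c1 c2; rewrite exchange_tlift.
  by apply: eq_tlift => d1 d2; rewrite tlift_tens_comul //; tlin.
rewrite (sweedlerA (F := fun c1 c2 c3 => \sw_(d1, d2 <- d)
    \sw_(d11, d12 <- d1) ((c1 \ox d11) \ox (c2 \ox d12)) \ox (c3 \ox d2)));
  [|by tlin..].
apply: eq_tlift => c1 c2.
transitivity (\sw_(c21, c22 <- c2) \sw_(d1, d2 <- d) \sw_(d21, d22 <- d2)
    ((c1 \ox d1) \ox (c21 \ox d21)) \ox (c22 \ox d22)).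
  apply: eq_tlift => c21 c22.
  by rewrite (sweedlerA (F := fun d1 d2 d3 =>
    ((c1 \ox d1) \ox (c21 \ox d2)) \ox (c22 \ox d3))) //; tlin.
rewrite exchange_tlift; apply: eq_tlift => d1 d2.
by rewrite tlift_tens_comul //; tlin.
Qed.

Fact tens_counitl (x : C \ox D) :
  tlift (fun x1 x2 => tens_counit x1 *: x2) (tens_comul x) = x.
Proof.
move: x; apply: tensor_ext; [by tlin|by tlin|move=> c d].
rewrite tlift_tens_comul; last by tlin.
rewrite -[in RHS](counitl c) -[in RHS](counitl d).
rewrite (linear_tlift _ _ (fun a x y => (tens_bilin C D).1 _ a x y)).
apply: eq_tlift => c1 c2.
rewrite (linear_tlift _ _ ((tens_bilin C D).2 _)).
apply: eq_tlift => d1 d2; rewrite tens_counitE.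
rewrite (lin_scale ((tens_bilin C D).1 _)) (lin_scale ((tens_bilin C D).2 _)).
by rewrite scalerA.
Qed.

Fact tens_counitr (x : C \ox D) :
  tlift (fun x1 x2 => tens_counit x2 *: x1) (tens_comul x) = x.
Proof.
move: x; apply: tensor_ext; [by tlin|by tlin|move=> c d].
rewrite tlift_tens_comul; last by tlin.
rewrite -[in RHS](counitr c) -[in RHS](counitr d).
rewrite (linear_tlift _ _ (fun a x y => (tens_bilin C D).1 _ a x y)).
apply: eq_tlift => c1 c2.
rewrite (linear_tlift _ _ ((tens_bilin C D).2 _)).
apply: eq_tlift => d1 d2; rewrite tens_counitE.
rewrite (lin_scale ((tens_bilin C D).1 _)) (lin_scale ((tens_bilin C D).2 _)).
by rewrite scalerA.
Qed.

HB.instance Definition _ := isCoalgebra.Build k (C \ox D)%type tens_comul_linear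
  tens_counit_scalar tens_comulA tens_counitl tens_counitr.

End TensorCoalgebra.

HB.mixin Record isBialgebra (k : fieldType) H
    of GRing.Algebra k H & Coalgebra k H := {
  comul1 : comul (1 : H) = 1 \ox 1;
  comulM : forall x y : H, comul (x * y) =
    \sw_(x1, x2 <- x) \sw_(y1, y2 <- y) (x1 * y1) \ox (x2 * y2);
  counit1 : counit (1 : H) = 1;
  counitM : forall x y : H, counit (x * y) = counit x * counit y;
}.

#[short(type="bialgType")]
HB.structure Definition Bialgebra (k : fieldType) :=
  { H of GRing.Algebra k H & Coalgebra k H & isBialgebra k H }.

HB.mixin Record hasAntipode (k : fieldType) H of Bialgebra k H := {
  antipode : H -> H;
  antipode_linear : linear antipode;
  antipodel : forall x : H,
    \sw_(x1, x2 <- x) antipode x1 * x2 = counit x *: 1;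
  antipoder : forall x : H,
    \sw_(x1, x2 <- x) x1 * antipode x2 = counit x *: 1;
}.

#[short(type="hopfAlgType")]
HB.structure Definition HopfAlgebra (k : fieldType) :=
  { H of Bialgebra k H & hasAntipode k H }.

Section BraceMaps.
Variables (k : fieldType) (H : hopfAlgType k).
Variables (dot col : H \ox H -> H).

Definition gbar : H \ox H -> H \ox H :=
  tlift (fun x y => \sw_(y1, y2 <- y) dot (x \ox y1) \ox y2).

(* The Sweedler indices are those of H, although y is taken in H^cop. *)
Definition qexch : H \ox H^cop -> H^cop \ox H :=
  tlift (fun (x : H) (y : H^cop) =>
    \sw_(x1, x2 <- x) \sw_(y1, y2 <- (y : H))
      (col (y1 \ox x2) : H^cop) \ox dot (x1 \ox y2)).

End BraceMaps.

Section Brace.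
Variables (k : fieldType) (H : hopfAlgType k).

(* gbar_inv is not extra structure, being determined by qdot. *)
Record hopfQBrace : Type := HopfQBrace {
  qdot : {linear (H \ox H)%type -> H};
  qcol : {linear (H \ox H)%type -> H};
  gbar_inv : H \ox H -> H \ox H;
  qdot_counit : forall x y, counit (qdot (x \ox y)) = counit x * counit y;
  qcol_counit : forall x y, counit (qcol (x \ox y)) = counit x * counit y;
  qexch_morph : coalg_morphism (qexch qdot qcol);
  gbarK : cancel (gbar qdot) gbar_inv;
  gbar_invK : cancel gbar_inv (gbar qdot);
  qdot_dot_col : forall x y z,
    \sw_(y1, y2 <- y) qdot (qdot (x \ox y1) \ox qcol (z \ox y2)) =
    \sw_(z1, z2 <- z) qdot (qdot (x \ox z2) \ox qdot (y \ox z1));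
  qcol_dot_dot : forall x y z,
    \sw_(y1, y2 <- y) qcol (qdot (x \ox y1) \ox qdot (z \ox y2)) =
    \sw_(z1, z2 <- z) qdot (qcol (x \ox z2) \ox qcol (y \ox z1));
  qcol_col_col : forall x y z,
    \sw_(y1, y2 <- y) qcol (qcol (x \ox y1) \ox qcol (z \ox y2)) =
    \sw_(z1, z2 <- z) qcol (qcol (x \ox z2) \ox qdot (y \ox z1));
  qdot1 : forall h, qdot (h \ox 1) = h;
  qdotM : forall h m l, qdot (h \ox (m * l)) = qdot (qdot (h \ox l) \ox m);
  qcol1 : forall h, qcol (h \ox 1) = h;
  qcolM : forall h m l, qcol (h \ox (m * l)) = qcol (qcol (h \ox l) \ox m);
  qdot_mul : forall h m l, qdot ((h * m) \ox l) =
    \sw_(l1, l2 <- l) \sw_(m1, m2 <- m)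
      qdot (h \ox qcol (l1 \ox m2)) * qdot (m1 \ox l2);
  qcol_mul : forall h m l, qcol ((h * m) \ox l) =
    \sw_(l1, l2 <- l) \sw_(m1, m2 <- m)
      qcol (h \ox qdot (l1 \ox m2)) * qcol (m1 \ox l2)
}.

Variable B : hopfQBrace.

(* ract x y and lact x y are x^y = (id (x) counit) (gbar^-1 (x (x) y)) and    *)
(* ^x y = y_(2) : x^(y_(1)).                                                  *)
Definition ract (x y : H) : H :=
  tlift (fun a b => counit b *: a) (gbar_inv B (x \ox y)).

Definition lact (x y : H) : H :=
  \sw_(y1, y2 <- y) qcol B (y2 \ox ract x y1).

Definition braid : H \ox H -> H \ox H :=
  tlift (fun x y =>
    \sw_(x1, x2 <- x) \sw_(y1, y2 <- y) lact x2 y2 \ox ract x1 y1).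

Definition braid_tau (t : H^cop \ox H^cop) : H^cop \ox H^cop :=
  tswap (braid (tswap t)).

Lemma gbar_bilin :
  bilin (fun x y : H => \sw_(y1, y2 <- y) qdot B (x \ox y1) \ox y2).
Proof.
split=> [y|x]; last first.
  apply: linear_tlift_arg; last exact: comul_linear.
  split=> [b|a]; last by lin.
  by apply/linear_tensl/(linear_comp (linearP (qdot B))); lin.
apply: linear_tlift_fun => a b.
by apply/linear_tensl/(linear_comp (linearP (qdot B))); lin.
Qed.

Lemma gbarE x y : gbar (qdot B) (x \ox y) =
  \sw_(y1, y2 <- y) qdot B (x \ox y1) \ox y2.
Proof. exact: tliftE gbar_bilin. Qed.

Lemma gbar_inv_linear : linear (gbar_inv B).
Proof.
move=> a s t; apply: (can_inj (gbarK B)).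
by rewrite gbar_invK [RHS](tlift_linear gbar_bilin) -/(gbar _) !gbar_invK.
Qed.

Lemma ract_bilin : bilin ract.
Proof.
split=> [y|x]; (apply: linear_tlift_arg; first by lin);
  by apply: (linear_comp gbar_inv_linear); lin.
Qed.

Lemma lact_bilin : bilin lact.
Proof.
split=> [y|x].
  apply: linear_tlift_fun => a b; apply: (linear_comp (linearP (qcol B))).
  by apply: linear_tensr; apply: ract_bilin.1.
apply: linear_tlift_arg; last exact: comul_linear.
split=> [b|a]; apply: (linear_comp (linearP (qcol B))); last by lin.
by apply: linear_tensr; apply: ract_bilin.2.
Qed.

Lemma braid_bilin : bilin (fun x y : H =>
  \sw_(x1, x2 <- x) \sw_(y1, y2 <- y) lact x2 y2 \ox ract x1 y1).
Proof.
have [l1 l2] := lact_bilin; have [r1 r2] := ract_bilin.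
split=> [y|x].
  apply: linear_tlift_arg; last exact: comul_linear.
  split=> [x2|x1]; apply: linear_tlift_fun => y1 y2.
    by apply: linear_tensr; apply: r1.
  by apply: linear_tensl; apply: l1.
apply: linear_tlift_fun => x1 x2.
apply: linear_tlift_arg; last exact: comul_linear.
split=> [y2|y1]; first by apply: linear_tensr; apply: r2.
by apply: linear_tensl; apply: l2.
Qed.

Lemma braidE x y : braid (x \ox y) =
  \sw_(x1, x2 <- x) \sw_(y1, y2 <- y) lact x2 y2 \ox ract x1 y1.
Proof. exact: tliftE braid_bilin. Qed.

End Brace.

(* Main.v *)
Require Import Defs.
From HB Require Import structures.
From mathcomp Require Import all_boot all_algebra.
From mathcomp Require Import boolp.

Set Implicit Arguments.
Unset Strict Implicit.
Unset Printing Implicit Defensive.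

Import GRing.Theory.
Local Open Scope ring_scope.

(** Let C be the coalgebra of H and H^cop tensored together.  On C there are
    four maps to H: the two operations D (x (x) y) = x . y and
    P (x (x) y) = y : x, and the two projections U and X.  The maps D and U
    preserve the comultiplication, P and X reverse it, and the coalgebra
    morphism in the definition of a Hopf q-brace says exactly this about D and
    P together with the exchange rule P c1 (x) D c2 = P c2 (x) D c1; the same
    rule holds for U and X.  Writing everything in terms of one element c of C
    instead of two elements of H turns each computation into a manipulation of
    a single word of Sweedler factors.

    The braiding is best seen through the bijection gbar, for which
    gbar c = D c2 (x) X c1: the composite of the braiding with gbar is
    c |-> P c2 (x) U c1 (braid_gbar), that is x (x) y |-> y : x2 (x) x1.
    Since the operation : is a module structure, this map is inverted by
    z (x) x |-> x1 (x) z : S x2, so the braiding is bijective.  Since gbar is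
    onto, identities about the braiding need only be checked on gbar c, and
    there compatibility with comultiplication is two uses of the exchange
    rules (braid_comul_gbar).

    For the square, the compatibility of the operations with the product of H
    shows that S (U c1) . P c2 is a left convolution inverse of D, hence equals
    S (D c) (antipode_action).  The module axiom then yields
    S (D c1) . S (P c2) = S (U c), and symmetrically
    S (P c2) : S (D c1) = S (X c).  With z = S (D c1) (x) S (P c2) the first
    of these gives gbar z = S (U c1) (x) S (P c2), and the second shows that the
    braiding sends gbar z to S (X c1) (x) S (D c2) (braid_antipode).  As the
    conjugate of the braiding by the flip sends X c1 (x) D c2 to U c1 (x) P c2,
    this is the commutativity of the square. *)

(** * Linear and multilinear expressions *)

Section Multilinear.
Variables (k : fieldType) (X : lmodType k) (A : algType k).

Lemma linear_mull (f : X -> A) (v : A) : linear f -> linear (fun x => f x * v).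
Proof. by move=> fl a x y; rewrite fl mulrDl scalerAl. Qed.

Lemma linear_mulr (v : A) (f : X -> A) : linear f -> linear (fun x => v * f x).
Proof. by move=> fl a x y; rewrite fl mulrDr scalerAr. Qed.

End Multilinear.

Lemma bilin_comp (k : fieldType) (Y V V' W : lmodType k)
    (F : V -> V' -> W) (f : Y -> V) (g : Y -> V') :
  bilin F -> linear f -> linear g -> bilin (fun a b => F (f a) (g b)).
Proof.
move=> [F1 F2] fl gl.
by split=> ?; [exact: (linear_comp (F1 _) fl)|exact: (linear_comp (F2 _) gl)].
Qed.

Lemma bilin_compC (k : fieldType) (Y V V' W : lmodType k)
    (F : V -> V' -> W) (f : Y -> V) (g : Y -> V') :
  bilin F -> linear f -> linear g -> bilin (fun a b => F (f b) (g a)).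
Proof.
move=> [F1 F2] fl gl.
by split=> ?; [exact: (linear_comp (F2 _) gl)|exact: (linear_comp (F1 _) fl)].
Qed.

(** Proves linearity from the syntactic shape of the body alone: choosing the
    closure lemma by unification would compare the convertible module
    structures of C^cop and C over and over. *)
Ltac mlin := repeat
  match goal with
  | |- forall _, _ => intro
  | |- bilin _ => split
  | |- linear (fun x => x) => exact: linear_idfun
  | Hl : linear ?g |- linear ?g => exact: Hl
  | Hl : linear ?g |- linear (fun x => ?g (@?f x)) =>
    apply: (@linear_comp _ _ _ _ g f Hl)
  | |- linear comul => exact: comul_linear
  | |- linear antipode => exact: antipode_linear
  | |- linear (fun x => comul (@?f x)) =>
    apply: (linear_comp (f := f) (@comul_linear _ _))
  | |- linear (fun x => antipode (@?f x)) =>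
    apply: (linear_comp (f := f) (@antipode_linear _ _))
  | |- linear (fun x => (GRing.Linear.sort ?g) (@?f x)) =>
    apply: (linear_comp (f := f) (linearP g))
  | |- linear (GRing.Linear.sort ?g) => exact: (linearP g)
  | |- linear (fun x => (@?f x) \ox ?v) => apply: (linear_tensl (f := f))
  | |- linear (fun x => ?u \ox (@?f x)) => apply: (linear_tensr _ (f := f))
  | |- linear (tens ?u) => apply: linear_tensr
  | |- linear (fun x => counit (@?f x) *: ?v) =>
    apply: (linear_counit_scale (f := f))
  | |- linear (fun x => ?a *: (@?f x)) => apply: (linear_scale_fun _ (f := f))
  | |- linear (fun x => (@?f x) * ?v) => apply: (linear_mull (f := f))
  | |- linear (fun x => ?v * (@?f x)) => apply: (linear_mulr _ (f := f))
  | |- linear ( *%R ?v) => apply: linear_mulr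
  | |- linear (fun x => tlift (@?F x) ?t) => apply: (linear_tlift_fun (F := F))
  | |- linear (fun x => tlift ?F (@?f x)) => apply: (linear_tlift_arg (f := f))
  | |- linear (tlift ?F) => apply: tlift_linear
  end.

(** * Sweedler calculus and coalgebra maps *)
Lemma sw_cop (k : fieldType) (C : coalgType k) (W : lmodType k)
    (F : C^cop -> C^cop -> W) (x : C) :
  bilin F -> tlift F (comul (x : C^cop)) = \sw_(a, b <- x) F b a.
Proof. exact: (@tlift_cop k C W F x). Qed.

Section CoalgebraMaps.
Variables (k : fieldType) (C D : coalgType k).

Lemma sw_coalg (f : C -> D) (W : lmodType k) (F : D -> D -> W) (c : C) :
  coalg_morphism f -> bilin F ->
  \sw_(a, b <- f c) F a b = \sw_(a, b <- c) F (f a) (f b).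
Proof.
move=> [_ _ ->] Fb; rewrite /tmap (linear_tlift _ _ (tlift_linear Fb)).
by apply: eq_tlift => a b; rewrite tliftE.
Qed.

Lemma tlift_tens (U V : lmodType k) (t : U \ox V) :
  tlift (fun u v => u \ox v) t = t.
Proof. by rewrite -tensE. Qed.

Lemma coalg_morphismP (f : C -> D) :
  linear f -> (forall c, counit (f c) = counit c) ->
  (forall c, comul (f c) = \sw_(a, b <- c) f a \ox f b) -> coalg_morphism f.
Proof. by move=> fl fe fc; split. Qed.

End CoalgebraMaps.

(** The same thing as a coalgebra morphism to D^cop or from C^cop, but stated
    with values in D itself, so that products in D can be formed. *)
Definition coalg_antimorphism (k : fieldType) (C D : coalgType k) (f : C -> D) :
    Prop :=
  [/\ linear f,
      forall c, counit (f c) = counit c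
    & forall c, comul (f c) = \sw_(a, b <- c) f b \ox f a].

Section MoreCoalgebraMaps.
Variables (k : fieldType) (C D : coalgType k).

Lemma sw_anticoalg (f : C -> D) (W : lmodType k) (F : D -> D -> W) (c : C) :
  coalg_antimorphism f -> bilin F ->
  \sw_(a, b <- f c) F a b = \sw_(a, b <- c) F (f b) (f a).
Proof.
move=> [_ _ ->] Fb; rewrite (linear_tlift _ _ (tlift_linear Fb)).
by apply: eq_tlift => a b; rewrite tliftE.
Qed.

Lemma coalg_antimorphism_cop (f : C -> D) :
  coalg_morphism f -> coalg_antimorphism (C := C^cop%type) f.
Proof.
move=> [fl fe fc]; split=> // c.
by rewrite [LHS]fc /tmap sw_cop //; mlin.
Qed.

Lemma coalg_morphism_cop (f : C -> D) :
  coalg_antimorphism f -> coalg_morphism (C := C^cop%type) f.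
Proof.
move=> [fl fe fc]; split=> // c.
by rewrite [LHS]fc /tmap sw_cop //; mlin.
Qed.

Lemma coalg_morphism_codom (f : C -> D) :
  coalg_antimorphism f -> coalg_morphism (D := D^cop%type) f.
Proof.
move=> [fl fe fc]; split=> // c; rewrite [LHS](congr1 (@tswap k D D) (fc c)).
rewrite (linear_tlift _ _ (@tswap_linear k D D)) /tmap.
by apply: eq_tlift => a b; apply: (tliftE (f := fun u v : D => v \ox u)); mlin.
Qed.

Lemma coalg_antimorphism_codom (f : C -> D) :
  coalg_morphism (D := D^cop%type) f -> coalg_antimorphism f.
Proof.
move=> fm; have [fl fe _] := fm; split=> // c.
pose F (a b : D^cop) : D \ox D := b \ox a.
have Fb : bilin F by rewrite /F; mlin.
rewrite -(@sw_coalg _ _ D^cop f _ F c fm Fb) -[LHS]tlift_tens.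
by rewrite sw_cop.
Qed.

Lemma coalg_morphism_copcop (f : C -> D) :
  coalg_morphism f -> coalg_morphism (C := C^cop%type) (D := D^cop%type) f.
Proof.
move=> fm; have [fl fe _] := fm; split=> // c; rewrite /tmap sw_cop; last by mlin.
apply: (etrans _ (@sw_coalg k C D f _
  (fun a b : D => (b : D^cop) \ox (a : D^cop)) c fm _)); first by [].
by mlin.
Qed.

Lemma coalg_morphism_inv (f : C -> D) (g : D -> C) :
  cancel f g -> cancel g f -> coalg_morphism f -> coalg_morphism g.
Proof.
move=> fK gK fm; have [fl fe fc] := fm.
have gl : linear g by move=> a x y; apply: (can_inj fK); rewrite fl !gK.
apply: coalg_morphismP => // [c|c]; first by rewrite -fe gK.
rewrite -{2}[c]gK sw_coalg //; last by mlin.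
rewrite -[LHS]tlift_tens; apply: eq_tlift => a b.
by rewrite !fK.
Qed.

(** Coassociativity as a rewriting rule on right-nested words: two adjacent
    factors that only occur through a known Sweedler sum are fused into one. *)
Lemma sw_merge (W : lmodType k) (G : C -> C -> C -> W) (K : C -> C -> W) c :
  (forall b d, linear (fun a => G a b d)) ->
  (forall a d, linear (fun b => G a b d)) ->
  (forall a b, linear (fun d => G a b d)) ->
  (forall m d, \sw_(a, b <- m) G a b d = K m d) ->
  \sw_(a, r <- c) \sw_(b, d <- r) G a b d = \sw_(m, d <- c) K m d.
Proof.
move=> l1 l2 l3 GK; rewrite -(sweedlerA (F := G)) //.
by apply: eq_tlift => m d; rewrite GK.
Qed.

Lemma sw_counitl (W : lmodType k) (F : C -> W) c :
  linear F -> \sw_(a, b <- c) counit a *: F b = F c.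
Proof.
move=> Fl; rewrite -{2}[c]counitl (linear_tlift _ _ Fl).
by apply: eq_tlift => a b; rewrite (lin_scale Fl).
Qed.

Lemma sw_counitr (W : lmodType k) (F : C -> W) c :
  linear F -> \sw_(a, b <- c) counit b *: F a = F c.
Proof.
move=> Fl; rewrite -{2}[c]counitr (linear_tlift _ _ Fl).
by apply: eq_tlift => a b; rewrite (lin_scale Fl).
Qed.

(** A left and a right convolution inverse of g agree: both equal f * g * h.
    The product is any unital associative operation, so that the componentwise
    product of a tensor square is covered. *)
Lemma convolution_inverse_unique (A : lmodType k) (op : A -> A -> A) (e : A)
    (f g h : C -> A) :
  bilin op -> associative op -> left_id e op -> right_id e op ->
  linear f -> linear g -> linear h ->
  (forall c, \sw_(a, b <- c) op (f a) (g b) = counit c *: e) ->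
  (forall c, \sw_(a, b <- c) op (g a) (h b) = counit c *: e) ->
  f =1 h.
Proof.
move=> [opl opr] opA op1l op1r fl gl hl fg gh c.
have opl' (V : lmodType k) (q : V -> A) v : linear q -> linear (fun x => op (q x) v).
  exact: (linear_comp (opl v)).
have opr' (V : lmodType k) v (q : V -> A) : linear q -> linear (fun x => op v (q x)).
  exact: (linear_comp (opr v)).
transitivity (\sw_(a, r <- c) \sw_(b, d <- r) op (op (f a) (g b)) (h d)).
  rewrite -sw_counitr //; apply: eq_tlift => a r.
  rewrite -{1}[f a]op1r -(lin_scale (opr _)) -gh (linear_tlift _ _ (opr _)).
  by apply: eq_tlift => b d; rewrite opA.
rewrite (sw_merge (K := fun m d => op (counit m *: e) (h d))).
- rewrite -[RHS]sw_counitl //; apply: eq_tlift => a b.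
  by rewrite (lin_scale (opl _)) op1l.
- by move=> b d; do 2![apply: (opl')].
- by move=> b d; apply/opl'/opr'.
- by move=> b d; apply: opr'.
- by move=> m d; rewrite -fg (linear_tlift _ _ (opl _)).
Qed.

End MoreCoalgebraMaps.

Lemma coalg_morphism_comp (k : fieldType) (C D E : coalgType k)
    (g : D -> E) (f : C -> D) :
  coalg_morphism g -> coalg_morphism f -> coalg_morphism (fun x => g (f x)).
Proof.
move=> gm fm; have [gl ge gc] := gm; have [fl fe fc] := fm.
apply: coalg_morphismP => [|c|c]; first exact: linear_comp.
  by rewrite ge fe.
by rewrite gc /tmap sw_coalg //; mlin.
Qed.

(** * The antipode reverses the comultiplication *)
Section TensorProductAlgebra.
Variables (k : fieldType) (A B : algType k).

Definition tmul (s t : A \ox B) : A \ox B :=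
  tlift (fun a b => tlift (fun c d => (a * c) \ox (b * d)) t) s.

Lemma tmulE a b c d : tmul (a \ox b) (c \ox d) = (a * c) \ox (b * d).
Proof. by rewrite /tmul !tliftE //; mlin. Qed.

Lemma tmul_bilin : bilin tmul.
Proof. by rewrite /tmul; mlin. Qed.

Lemma tmulA : associative tmul.
Proof.
have [ml mr] := tmul_bilin.
have ml' v (f : A \ox B -> A \ox B) : linear f -> linear (fun x => tmul (f x) v).
  exact: (linear_comp (ml v)).
have mr' v (f : A \ox B -> A \ox B) : linear f -> linear (fun x => tmul v (f x)).
  exact: (linear_comp (mr v)).
have id_lin := @linear_idfun k (A \ox B)%type.
move=> r s t; move: r; apply: tensor_ext => [||a b].
- exact: ml'.
- by do 2![apply: (ml')].
move: s; apply: tensor_ext => [||c d].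
- by apply/mr'/ml'.
- by apply/ml'/mr'.
move: t; apply: tensor_ext => [||e f].
- by do 2![apply: (mr')].
- exact: mr'.
by rewrite !tmulE !mulrA.
Qed.

Lemma tmul1l : left_id (1 \ox 1) tmul.
Proof.
apply: tensor_ext => [||a b]; [exact: tmul_bilin.2|by []|].
by rewrite tmulE !mul1r.
Qed.

Lemma tmul1r : right_id (1 \ox 1) tmul.
Proof.
apply: tensor_ext => [||a b]; [exact: tmul_bilin.1|by []|].
by rewrite tmulE !mulr1.
Qed.

End TensorProductAlgebra.

Section Antipode.
Variables (k : fieldType) (H : hopfAlgType k).
Local Notation S := (@antipode k H).

Lemma antipode_counit (x : H) : counit (S x) = counit x.
Proof.
have el : linear (counit : H -> k^o) := @counit_scalar k H.
have Sl := @antipode_linear k H.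
have := congr1 (counit : H -> k^o) (antipodel x).
rewrite (linear_tlift _ _ el) (lin_scale el) counit1.
have -> : counit x *: 1 = counit x :> k^o by exact: mulr1.
move=> <-.
rewrite -[LHS](@sw_counitr _ _ k^o (fun y => counit (S y)) x);
  last exact: linear_comp el Sl.
by apply: (@eq_tlift _ _ _ k^o) => a b; rewrite counitM mulrC.
Qed.

(** Both comul o S and the flipped square of S are convolution inverses of
    comul, on the left and on the right respectively. *)
Lemma antipode_comul (x : H) : comul (S x) = \sw_(a, b <- x) S b \ox S a.
Proof.
have [ml mr] := tmul_bilin H H.
move: x; apply: (convolution_inverse_unique (f := fun x => comul (S x))
  (g := comul) (h := fun x => \sw_(a, b <- x) S b \ox S a)
  (tmul_bilin H H) (@tmulA _ H H) (@tmul1l _ H H) (@tmul1r _ H H)).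
- by mlin.
- exact: comul_linear.
- by mlin.
- move=> c.
  transitivity (comul (\sw_(a, b <- c) S a * b)).
    rewrite (linear_tlift _ _ (@comul_linear _ _)); apply: eq_tlift => a b.
    by rewrite comulM.
  by rewrite antipodel (lin_scale (@comul_linear _ _)) comul1.
move=> c.
transitivity (\sw_(a, r <- c) \sw_(p, q <- r)
   \sw_(a1, a2 <- a) (a1 * S q) \ox (a2 * S p)).
  apply: eq_tlift => a r; rewrite (linear_tlift _ _ (mr _)).
  apply: eq_tlift => p q; rewrite /tmul.
  by apply: eq_tlift => a1 a2; rewrite tliftE //; mlin.
rewrite (sw_merge (K := fun m q => (m * S q) \ox 1)); try by mlin.
  rewrite -(linear_tlift (fun a b => a * S b) _ ((tens_bilin _ _).1 _)).
  by rewrite antipoder (lin_scale ((tens_bilin _ _).1 _)).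
move=> m q; rewrite (sweedlerA (F := fun a1 a2 p => (a1 * S q) \ox (a2 * S p)));
  try by mlin.
transitivity (\sw_(a, b <- m) counit b *: ((a * S q) \ox (1 : H))).
  apply: eq_tlift => a b.
  by rewrite -(linear_tlift (fun a b => a * S b) _ ((tens_bilin _ _).2 _))
    antipoder (lin_scale ((tens_bilin _ _).2 _)).
by rewrite (sw_counitr (F := fun a => (a * S q) \ox (1 : H))) //; mlin.
Qed.

Lemma antipode_antimorph : coalg_antimorphism S.
Proof.
by split; [exact: antipode_linear|exact: antipode_counit|exact: antipode_comul].
Qed.

End Antipode.

(** * One operation of a brace, translated by the antipode *)

(** The hypotheses are those shared by the two operations of a Hopf q-brace:
    for the operation : they hold on the co-opposite of C, with D and P
    exchanged, and U and X exchanged.  All that follows is thus available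
    twice. *)
Section OneSidedBrace.
Variables (k : fieldType) (C : coalgType k) (H : hopfAlgType k).
Variables (D P U X : C -> H) (dot : {linear (H \ox H)%type -> H}).
Local Notation S := (@antipode k H).
Hypotheses (Dm : coalg_morphism D) (Um : coalg_morphism U)
  (Pm : coalg_antimorphism P) (Xm : coalg_antimorphism X).
Hypothesis dotM : forall h m l, dot (h \ox (m * l)) = dot (dot (h \ox l) \ox m).
Hypothesis dot1 : forall h, dot (h \ox 1) = h.
Hypothesis dot1l : forall l, dot (1 \ox l) = counit l *: 1.
Hypothesis dot_mul : forall h c,
  \sw_(a, b <- c) dot ((h * U a) \ox X b) =
  \sw_(a, b <- c) dot (h \ox P a) * D b.

Let Dl : linear D. Proof. by case: Dm. Qed.
Let Ul : linear U. Proof. by case: Um. Qed.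
Let Pl : linear P. Proof. by case: Pm. Qed.
Let Xl : linear X. Proof. by case: Xm. Qed.
Let De c : counit (D c) = counit c. Proof. by case: Dm. Qed.
Let Ue c : counit (U c) = counit c. Proof. by case: Um. Qed.
Let Pe c : counit (P c) = counit c. Proof. by case: Pm. Qed.
Let Xe c : counit (X c) = counit c. Proof. by case: Xm. Qed.

(** In convolution with D, the left-hand side gives the action of X
    on S (U c1) U c2 = 1, which is trivial; so it is a left convolution inverse
    of D, while S o D is a right one. *)
Lemma antipode_action (c : C) :
  \sw_(a, b <- c) dot (S (U a) \ox P b) = S (D c).
Proof.
move: c; apply: (convolution_inverse_unique
  (f := fun c => \sw_(a, b <- c) dot (S (U a) \ox P b))
  (g := D) (h := fun c => S (D c)) (op := fun x y : H => x * y) (e := 1)).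
- by mlin.
- exact: mulrA.
- exact: mul1r.
- exact: mulr1.
- by mlin.
- by mlin.
- by mlin.
- move=> c; transitivity
    (\sw_(a, r <- c) \sw_(b, d <- r) dot (S (U a) \ox P b) * D d).
    rewrite -(sweedlerA (F := fun a b d => dot (S (U a) \ox P b) * D d)); try by mlin.
    apply: eq_tlift => a b.
    by rewrite (linear_tlift _ _ (@linear_mull _ _ _ id (D b) (@linear_idfun _ _))).
  transitivity
    (\sw_(a, r <- c) \sw_(b, d <- r) dot ((S (U a) * U b) \ox X d)).
    by apply: eq_tlift => a r; rewrite dot_mul.
  (* The first two factors form the antipode identity of U m. *)
  rewrite (sw_merge (K := fun m d => counit m *: dot (1 \ox X d))); try by mlin.
    rewrite sw_counitl; last by mlin.
    by rewrite dot1l Xe.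
  move=> m d.
  have Gl : linear (fun x => dot (x \ox X d)) by mlin.
  rewrite -(linear_tlift (fun a b => S (U a) * U b) _ Gl).
  rewrite -(sw_coalg (F := fun a b => S a * b) _ Um); last by mlin.
  by rewrite antipodel Ue (lin_scale Gl).
move=> c; rewrite -(sw_coalg (F := fun a b => a * S b) _ Dm); last by mlin.
by rewrite antipoder De.
Qed.

(** Acting by S (P c3) on S (U c1) . P c2 is acting on S (U c1) by
    S (P c3) P c2, which is 1 because P reverses the comultiplication. *)
Lemma antipode_action_antipode (c : C) :
  \sw_(a, b <- c) dot (S (D a) \ox S (P b)) = S (U c).
Proof.
transitivity (\sw_(a, r <- c) \sw_(b, d <- r) dot (S (U a) \ox (S (P d) * P b))).
  rewrite -(sweedlerA (F := fun a b d => dot (S (U a) \ox (S (P d) * P b))));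
    try by mlin.
  apply: eq_tlift => a b.
  have Gl : linear (fun x => dot (x \ox S (P b))) by mlin.
  rewrite -antipode_action (linear_tlift _ _ Gl).
  by apply: eq_tlift => e f; rewrite dotM.
transitivity (\sw_(a, r <- c) counit r *: S (U a)).
  apply: eq_tlift => a r.
  have Gl : linear (fun x => dot (S (U a) \ox x)) by mlin.
  rewrite -(linear_tlift (fun b d => S (P d) * P b) _ Gl).
  rewrite -(sw_anticoalg (F := fun a b => S a * b) _ Pm); last by mlin.
  by rewrite antipodel Pe (lin_scale Gl) dot1.
by rewrite (sw_counitr (F := fun a => S (U a))) //; mlin.
Qed.

End OneSidedBrace.

(** * A tensor product of coalgebras and its projections *)
Section TensorProjections.
Variables (k : fieldType) (C D : coalgType k).

Definition tprojl (z : C \ox D) : C := tlift (fun u v => counit v *: u) z.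
Definition tprojr (z : C \ox D) : D := tlift (fun u v => counit u *: v) z.

Lemma tprojl_bilin : bilin (fun (u : C) (v : D) => counit v *: u).
Proof. by mlin. Qed.

Lemma tprojr_bilin : bilin (fun (u : C) (v : D) => counit u *: v).
Proof. by mlin. Qed.

Lemma tprojl_linear : linear tprojl.
Proof. exact: tlift_linear tprojl_bilin. Qed.

Lemma tprojr_linear : linear tprojr.
Proof. exact: tlift_linear tprojr_bilin. Qed.

Lemma tprojlE u v : tprojl (u \ox v) = counit v *: u.
Proof. exact: tliftE tprojl_bilin. Qed.

Lemma tprojrE u v : tprojr (u \ox v) = counit u *: v.
Proof. exact: tliftE tprojr_bilin. Qed.

Lemma counit_tens u v : counit (u \ox v : C \ox D) = counit u * counit v.
Proof. exact: tens_counitE. Qed.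

Lemma tprojl_coalg : coalg_morphism tprojl.
Proof.
have pl := tprojl_linear.
apply: coalg_morphismP => //.
  apply: (@tensor_ext _ _ _ k^o (fun z => counit (tprojl z)) (fun z => counit z)).
  - by move=> a x y; rewrite pl counit_scalar.
  - exact: counit_scalar.
  move=> u v; rewrite tprojlE counit_tens.
  by rewrite (lin_scale (@counit_scalar k C : linear (counit : C -> k^o))) mulrC.
apply: tensor_ext => [||u v]; [by mlin|by mlin|].
rewrite tprojlE (lin_scale (@comul_linear _ _)).
rewrite (tlift_tens_comul (F := fun a b => tprojl a \ox tprojl b)); last by mlin.
rewrite -[X in _ *: X]tlift_tens.
rewrite (linear_tlift _ _ (@linear_scale_fun _ _ _ (counit v) id (@linear_idfun _ _))).
apply: eq_tlift => u1 u2.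
transitivity (\sw_(v1, v2 <- v) counit v1 *: (counit v2 *: (u1 \ox u2))).
  rewrite (sw_counitl (F := fun y => counit y *: (u1 \ox u2))) //.
  exact: linear_counitl.
apply: eq_tlift => v1 v2; rewrite !tprojlE.
by rewrite (lin_scale ((tens_bilin _ _).1 _)) (lin_scale ((tens_bilin _ _).2 _)).
Qed.

Lemma tprojr_coalg : coalg_morphism tprojr.
Proof.
have pl := tprojr_linear.
apply: coalg_morphismP => //.
  apply: (@tensor_ext _ _ _ k^o (fun z => counit (tprojr z)) (fun z => counit z)).
  - by move=> a x y; rewrite pl counit_scalar.
  - exact: counit_scalar.
  move=> u v; rewrite tprojrE counit_tens.
  by rewrite (lin_scale (@counit_scalar k D : linear (counit : D -> k^o))).
apply: tensor_ext => [||u v]; [by mlin|by mlin|].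
rewrite tprojrE (lin_scale (@comul_linear _ _)).
rewrite (tlift_tens_comul (F := fun a b => tprojr a \ox tprojr b)); last by mlin.
transitivity (\sw_(u1, u2 <- u) counit u1 *: (counit u2 *: comul v)).
  rewrite (sw_counitl (F := fun y => counit y *: comul v)) //.
  exact: linear_counitl.
apply: eq_tlift => u1 u2; rewrite scalerA -[X in _ *: X]tlift_tens.
rewrite (linear_tlift _ _
  (@linear_scale_fun _ _ _ (counit u1 * counit u2) id (@linear_idfun _ _))).
apply: eq_tlift => v1 v2; rewrite !tprojrE -scalerA.
by rewrite (lin_scale ((tens_bilin _ _).1 _)) (lin_scale ((tens_bilin _ _).2 _)).
Qed.

(** Together with the next lemma: the two projections of a tensor product
    satisfy the exchange rule. *)
Lemma tens_tproj (z : C \ox D) : \sw_(a, b <- z) tprojl a \ox tprojr b = z.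
Proof.
have pl := tprojl_linear; have pr := tprojr_linear.
move: z; apply: tensor_ext => [||u v]; [by mlin|by []|].
rewrite (tlift_tens_comul (F := fun a b => tprojl a \ox tprojr b)); last by mlin.
rewrite -[RHS](@sw_counitr _ _ _ (fun u => u \ox v)); last by mlin.
apply: eq_tlift => u1 u2.
rewrite -(@sw_counitl _ _ _ (fun v => u1 \ox v)); last by mlin.
rewrite (linear_tlift _ _ (@linear_scale_fun _ _ _ (counit u2) id (@linear_idfun _ _))).
apply: eq_tlift => v1 v2; rewrite tprojlE tprojrE.
rewrite (lin_scale ((tens_bilin _ _).1 _)) (lin_scale ((tens_bilin _ _).2 _)).
by rewrite !scalerA mulrC.
Qed.

Lemma tens_tprojC (z : C \ox D) : \sw_(a, b <- z) tprojl b \ox tprojr a = z.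
Proof.
have pl := tprojl_linear; have pr := tprojr_linear.
move: z; apply: tensor_ext => [||u v]; [by mlin|by []|].
rewrite (tlift_tens_comul (F := fun a b => tprojl b \ox tprojr a)); last by mlin.
rewrite -[RHS](@sw_counitl _ _ _ (fun u => u \ox v)); last by mlin.
apply: eq_tlift => u1 u2.
rewrite -(@sw_counitr _ _ _ (fun v => u2 \ox v)); last by mlin.
rewrite (linear_tlift _ _ (@linear_scale_fun _ _ _ (counit u1) id (@linear_idfun _ _))).
apply: eq_tlift => v1 v2; rewrite tprojlE tprojrE.
rewrite (lin_scale ((tens_bilin _ _).1 _)) (lin_scale ((tens_bilin _ _).2 _)).
by rewrite !scalerA mulrC.
Qed.

End TensorProjections.

(** * Exchange rules *)
Section Cocommuting.
Variables (k : fieldType) (C : coalgType k).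

Definition cocommuting (V V' : lmodType k) (f : C -> V) (g : C -> V') : Prop :=
  forall c, \sw_(a, b <- c) f a \ox g b = \sw_(a, b <- c) f b \ox g a.

Lemma sw_cocommuting (V V' W : lmodType k) (f : C -> V) (g : C -> V')
    (F : V -> V' -> W) (c : C) :
  cocommuting f g -> bilin F ->
  \sw_(a, b <- c) F (f a) (g b) = \sw_(a, b <- c) F (f b) (g a).
Proof.
move=> fg Fb; have := congr1 (tlift F) (fg c).
rewrite !(linear_tlift _ _ (tlift_linear Fb)) => E.
transitivity (\sw_(a, b <- c) tlift F (f a \ox g b)).
  by apply: eq_tlift => a b; rewrite tliftE.
by rewrite E; apply: eq_tlift => a b; rewrite tliftE.
Qed.

Lemma sw_cocommuting12 (V V' W : lmodType k) (f : C -> V) (g : C -> V')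
    (F : V -> V' -> C -> W) (c : C) :
  cocommuting f g -> linear f -> linear g ->
  (forall v d, linear (fun u => F u v d)) ->
  (forall u d, linear (fun v => F u v d)) ->
  (forall u v, linear (fun d => F u v d)) ->
  \sw_(a, r <- c) \sw_(b, d <- r) F (f a) (g b) d =
  \sw_(a, r <- c) \sw_(b, d <- r) F (f b) (g a) d.
Proof.
move=> fg fl gl F1 F2 F3.
have F1' v d := linear_comp (F1 v d) fl.
have F2' u d := linear_comp (F2 u d) gl.
rewrite -(sweedlerA (F := fun a b d => F (f a) (g b) d)) //.
rewrite -(sweedlerA (F := fun a b d => F (f b) (g a) d)) //.
apply: eq_tlift => m d.
by apply: (sw_cocommuting (F := fun u v => F u v d)).
Qed.

Lemma counit_sw_tens (D E : coalgType k) (f : C -> D) (g : C -> E) c :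
  (forall c, counit (f c) = counit c) -> (forall c, counit (g c) = counit c) ->
  counit (\sw_(a, b <- c) f b \ox g a) = counit c.
Proof.
move=> fe ge.
have el : linear (counit : D \ox E -> k^o) := @counit_scalar _ _.
rewrite (linear_tlift _ _ el).
rewrite -[RHS](@sw_counitr _ _ k^o (counit : C -> k)); last exact: counit_scalar.
apply: (@eq_tlift _ _ _ k^o) => a b.
by rewrite [LHS]counit_tens fe ge.
Qed.

End Cocommuting.

(** Exchanging with the identity makes f compatible with comultiplication in
    both orders, so S o f is a right convolution inverse of f; an invertible
    idempotent of the convolution algebra is its unit. *)
Lemma cocommuting_idempotent (k : fieldType) (H : hopfAlgType k) (f : H -> H) :
  coalg_antimorphism f -> cocommuting id f ->
  (forall l, f l = \sw_(a, b <- l) f a * f b) ->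
  forall l, f l = counit l *: 1.
Proof.
move=> fm fC ff l; have [fl fe fc] := fm.
have fm' : coalg_morphism f.
  apply: coalg_morphismP => // c; rewrite fc.
  by rewrite (sw_cocommuting (F := fun x y => f x \ox y) (f := id)) //; mlin.
transitivity (\sw_(a, r <- l) \sw_(b, d <- r) (f a * f b) * antipode (f d)).
  transitivity (\sw_(a, r <- l) counit r *: f a); first by rewrite sw_counitr.
  apply: eq_tlift => a r.
  rewrite -[f a in LHS]mulr1 scalerAr -fe -antipoder.
  rewrite (linear_tlift _ _ (@linear_mulr _ _ _ (f a) id (@linear_idfun _ _))).
  rewrite (sw_coalg (F := fun x y => f a * (x * antipode y)) _ fm'); last by mlin.
  by apply: eq_tlift => b d; rewrite mulrA.
rewrite (sw_merge (K := fun m d => f m * antipode (f d))); try by mlin.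
  rewrite -(sw_coalg (F := fun x y => x * antipode y) _ fm'); last by mlin.
  by rewrite antipoder fe.
move=> m d; rewrite [f m]ff.
by rewrite (linear_tlift _ _
  (@linear_mull _ _ _ id (antipode (f d)) (@linear_idfun _ _))).
Qed.

(** * The two operations of a Hopf q-brace as maps on H (x) H^cop *)
Section Brace.
Variables (k : fieldType) (H : hopfAlgType k) (B : hopfQBrace H).
Local Notation C := (H \ox H^cop)%type.
Local Notation S := (@antipode k H).

Definition bdot (c : C) : H := qdot B (c : H \ox H).
Definition bcol (c : C) : H := qcol B (tswap (c : H \ox H)).
Definition bfst (c : C) : H := tprojl c.
Definition bsnd (c : C) : H := (tprojr c : H^cop).

Local Notation D := bdot.
Local Notation P := bcol.
Local Notation U := bfst.
Local Notation X := bsnd.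

Let Dl : linear D.
Proof. by move=> a x y; rewrite /bdot -linearP. Qed.
Let Pl : linear P.
Proof. by move=> a x y; rewrite /bcol [tswap _](@tswap_linear k H H a x y) linearP. Qed.
Let Ul : linear U. Proof. exact: tprojl_linear. Qed.
Let Xl : linear X. Proof. exact: (@tprojr_linear k H H^cop). Qed.

Lemma bdotE x y : D (x \ox y) = qdot B (x \ox y).
Proof. by []. Qed.

Lemma bcolE x y : P (x \ox y) = qcol B (y \ox x).
Proof.
rewrite /bcol; congr (qcol B _).
by apply: (tliftE x y (f := fun u v : H => v \ox u)); mlin.
Qed.

Lemma bfstE x y : U (x \ox y) = counit y *: x.
Proof. exact: (@tprojlE k H H^cop). Qed.

Lemma bsndE x y : X (x \ox y) = counit x *: y.
Proof. exact: (@tprojrE k H H^cop). Qed.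

Lemma sw_pair (W : lmodType k) (F : C -> C -> W) (x y : H) :
  bilin F ->
  \sw_(a, b <- (x \ox y : C)) F a b =
  \sw_(x1, x2 <- x)
    tlift (fun y1 y2 : H => F (x1 \ox (y2 : H^cop)) (x2 \ox (y1 : H^cop))) (comul y).
Proof.
move=> Fb; rewrite [LHS](@tlift_tens_comul k H H^cop W F x y Fb).
apply: eq_tlift => x1 x2.
have [Fl Fr] := Fb.
have l1 : linear (fun z : H^cop => (x1 \ox z : C)) by mlin.
have l2 : linear (fun z : H^cop => (x2 \ox z : C)) by mlin.
apply: (@sw_cop k H W (fun y1 y2 => F (x1 \ox y1) (x2 \ox y2))).
split=> [v|u]; first exact: (linear_comp (Fl _) l1).
exact: (linear_comp (Fr _) l2).
Qed.

Lemma bfst_morph : coalg_morphism U.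
Proof. exact: tprojl_coalg. Qed.

Lemma bsnd_antimorph : coalg_antimorphism X.
Proof. exact: coalg_antimorphism_codom (@tprojr_coalg k H H^cop). Qed.

(** This formula and qexchE' express the same map in the two possible
    Sweedler orders: the first is its definition, the second holds because a
    coalgebra morphism to a tensor product is determined by its projections. *)
Lemma qexchE (c : C) :
  qexch (qdot B) (qcol B) c = \sw_(a, b <- c) (P b : H^cop) \ox D a.
Proof.
have [ql _ _] := qexch_morph B.
pose P' : C -> H^cop := P; have Pl' : linear P' := Pl.
have Fb : bilin (fun a b => P' b \ox D a).
  by split=> [b|a]; [exact: (linear_tensr _ Dl)|exact: (linear_tensl _ Pl')].
move: c; apply: tensor_ext => [||x y]; [exact: ql| |].
  exact: linear_tlift_arg Fb (@comul_linear _ _).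
rewrite [RHS](sw_pair _ _ Fb).
have qb : bilin (fun (x : H) (y : H^cop) => \sw_(x1, x2 <- x)
    \sw_(y1, y2 <- (y : H)) (qcol B (y1 \ox x2) : H^cop) \ox qdot B (x1 \ox y2)).
  by mlin; exact: (@comul_linear k H).
rewrite [LHS](tliftE _ _ qb).
by apply: eq_tlift => x1 x2; apply: eq_tlift => y1 y2; rewrite /P' bcolE bdotE.
Qed.

Lemma bdot_counit (c : C) : counit (D c) = counit c.
Proof.
move: c; apply: (@tensor_ext _ _ _ k^o (fun c => counit (D c)) counit).
- by move=> a x y; rewrite Dl counit_scalar.
- exact: (@counit_scalar k C).
by move=> x y; rewrite bdotE qdot_counit [RHS]counit_tens.
Qed.

Lemma bcol_counit (c : C) : counit (P c) = counit c.
Proof.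
move: c; apply: (@tensor_ext _ _ _ k^o (fun c => counit (P c)) counit).
- by move=> a x y; rewrite Pl counit_scalar.
- exact: (@counit_scalar k C).
by move=> x y; rewrite bcolE qcol_counit [RHS]counit_tens mulrC.
Qed.

Lemma tprojr_qexch (c : C) : tprojr (qexch (qdot B) (qcol B) c) = D c.
Proof.
rewrite qexchE (linear_tlift _ _ (@tprojr_linear _ _ _)).
rewrite -[RHS](sw_counitr (F := D)) //.
by apply: eq_tlift => a b; rewrite tprojrE; congr (_ *: _); apply: bcol_counit.
Qed.

Lemma tprojl_qexch (c : C) : tprojl (qexch (qdot B) (qcol B) c) = P c.
Proof.
rewrite qexchE (linear_tlift _ _ (@tprojl_linear _ _ _)).
rewrite -[RHS](sw_counitl (F := P)) //.
by apply: eq_tlift => a b; rewrite tprojlE; congr (_ *: _); apply: bdot_counit.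
Qed.

Lemma bdot_morph : coalg_morphism D.
Proof.
have := coalg_morphism_comp (@tprojr_coalg _ _ _) (qexch_morph B).
by rewrite (funext tprojr_qexch).
Qed.

Lemma bcol_antimorph : coalg_antimorphism P.
Proof.
apply: coalg_antimorphism_codom.
have := coalg_morphism_comp (@tprojl_coalg _ _ _) (qexch_morph B).
by rewrite (funext tprojl_qexch).
Qed.

Lemma qexchE' (c : C) :
  qexch (qdot B) (qcol B) c = \sw_(a, b <- c) (P a : H^cop) \ox D b.
Proof.
rewrite -[LHS]tens_tproj.
rewrite (sw_coalg (F := fun a b => tprojl a \ox tprojr b) _ (qexch_morph B)).
  by apply: eq_tlift => a b; rewrite tprojl_qexch tprojr_qexch.
have pl := @tprojl_linear k H^cop H; have pr := @tprojr_linear k H^cop H.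
by mlin.
Qed.

Lemma bcol_bdotC : cocommuting P D.
Proof. by move=> c; exact: (etrans (esym (qexchE' c)) (qexchE c)). Qed.

Lemma bfst_bsndC : cocommuting U X.
Proof.
by move=> c; rewrite [LHS](@tens_tproj k H H^cop) [RHS](@tens_tprojC k H H^cop).
Qed.

Lemma sw_bfst_bsnd (W : lmodType k) (F : H -> H -> W) (c : C) : bilin F ->
  \sw_(a, b <- c) F (U a) (X b) = tlift F (c : H \ox H).
Proof.
move=> Fb.
rewrite -[RHS](congr1 (tlift F) (@tens_tproj k H H^cop c : _ = (c : H \ox H))).
rewrite (linear_tlift _ _ (tlift_linear Fb)).
by apply: eq_tlift => a b; rewrite tliftE.
Qed.

Let pairl (X : lmodType k) (f : X -> H) (y : H) :
  linear f -> linear (fun x => (f x \ox y : C)).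
Proof. exact: (@linear_tensl k X H H^cop). Qed.

Let pairr (X : lmodType k) (f : X -> H) (x : H) :
  linear f -> linear (fun y => (x \ox f y : C)).
Proof. exact: (@linear_tensr k X H H^cop). Qed.

Let bilin_pair (W : lmodType k) (F : C -> C -> W) : bilin F ->
  (forall y z : H, bilin (fun x1 x2 : H => F (x1 \ox z) (x2 \ox y))) *
  (forall x z : H, bilin (fun y1 y2 : H => F (x \ox y2) (z \ox y1))).
Proof.
move=> [Fl Fr]; split=> y z; split=> x.
- by apply: (linear_comp (Fl _)); apply: pairl.
- by apply: (linear_comp (Fr _)); apply: pairl.
- by apply: (linear_comp (Fr _)); apply: pairr.
- by apply: (linear_comp (Fl _)); apply: pairr.
Qed.

Lemma sw_pair1l (W : lmodType k) (F : C -> C -> W) (y : H) : bilin F ->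
  \sw_(a, b <- (1 \ox y : C)) F a b = \sw_(y1, y2 <- y) F (1 \ox y2) (1 \ox y1).
Proof.
move=> Fb; rewrite sw_pair // comul1 tliftE //.
have [F1 _] := bilin_pair Fb.
by split=> ?; apply: linear_tlift_fun => y1 y2; [exact: (F1 _ _).1|exact: (F1 _ _).2].
Qed.

Lemma sw_pair1r (W : lmodType k) (F : C -> C -> W) (x : H) : bilin F ->
  \sw_(a, b <- (x \ox 1 : C)) F a b = \sw_(x1, x2 <- x) F (x1 \ox 1) (x2 \ox 1).
Proof.
move=> Fb; rewrite sw_pair //; apply: eq_tlift => x1 x2.
have [_ F2] := bilin_pair Fb.
by rewrite comul1; apply: (tliftE (f := fun y1 y2 => F (x1 \ox y2) (x2 \ox y1))).
Qed.

(** The map l |-> 1 . l is idempotent for convolution by the product axiom with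
    h = m = 1, and the exchange rule at 1 (x) l makes it cocommute with id. *)
Lemma bdot1l (l : H) : qdot B (1 \ox l) = counit l *: 1.
Proof.
pose f l := D (1 \ox l); rewrite -[LHS]/(f l); move: l.
have [_ _ Dc] := bdot_morph.
apply: cocommuting_idempotent.
- split=> [|l|l].
  + by apply: (linear_comp Dl); apply: pairr.
  + by rewrite [LHS]qdot_counit counit1 mul1r.
  + by rewrite [LHS]Dc [LHS]sw_pair1l //; exact: bilin_comp (tens_bilin H H) Dl Dl.
- move=> l; have := bcol_bdotC (1 \ox l); have Fb := tens_bilin H H.
  rewrite !sw_pair1l; [|exact: (bilin_compC Fb Pl Dl)|exact: (bilin_comp Fb Pl Dl)].
  under eq_tlift do rewrite bcolE qcol1.
  by under [RHS]eq_tlift do rewrite bcolE qcol1.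
- move=> l; rewrite {1}/f -[in LHS](mulr1 (1 : H)) [LHS]qdot_mul.
  by apply: eq_tlift => l1 l2; rewrite comul1 tliftE ?qcol1 //; mlin.
Qed.

Lemma bcol1l (l : H) : qcol B (1 \ox l) = counit l *: 1.
Proof.
pose f l := P (l \ox 1); rewrite -bcolE -[LHS]/(f l); move: l.
have [_ _ Pc] := bcol_antimorph.
apply: cocommuting_idempotent.
- split=> [|l|l].
  + by apply: (linear_comp Pl); apply: pairl.
  + by rewrite /f bcolE qcol_counit counit1 mul1r.
  + by rewrite [LHS]Pc [LHS]sw_pair1r //; exact: bilin_compC (tens_bilin H H) Pl Pl.
- move=> l; symmetry.
  have Fb : bilin (fun x y : H => y \ox x) by mlin.
  have := sw_cocommuting (l \ox 1 : C) bcol_bdotC Fb.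
  rewrite !sw_pair1r; [|exact: (bilin_compC Fb Pl Dl)|exact: (bilin_comp Fb Pl Dl)].
  under eq_tlift do rewrite bdotE qdot1.
  by under [RHS]eq_tlift do rewrite bdotE qdot1.
- move=> l; rewrite -[LHS]/(P (l \ox 1)) bcolE -[in LHS](mulr1 (1 : H)) [LHS]qcol_mul.
  apply: eq_tlift => l1 l2; rewrite comul1 tliftE ?qdot1 //; last by mlin.
  by rewrite /f !bcolE.
Qed.

(** The product axiom, with its two arguments m and l packed into c; the exchange
    rule brings the Sweedler indices to the order used above. *)
Lemma bdot_mul (h : H) (c : C) :
  \sw_(a, b <- c) qdot B ((h * U a) \ox X b) =
  \sw_(a, b <- c) qdot B (h \ox P a) * D b.
Proof.
have Fb : bilin (fun u x : H => qdot B ((h * u) \ox x)) by mlin.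
have Gb : bilin (fun p d : H => qdot B (h \ox p) * d) by mlin.
transitivity (tlift (fun u x : H => qdot B ((h * u) \ox x)) (c : H \ox H)).
  exact: (sw_bfst_bsnd c Fb).
rewrite (sw_cocommuting c bcol_bdotC Gb).
have Gb' : bilin (fun a b => qdot B (h \ox P b) * D a).
  exact: bilin_compC Gb Pl Dl.
move: c; apply: tensor_ext => [||m l].
- exact: tlift_linear Fb.
- exact: linear_tlift_arg Gb' (@comul_linear _ _).
rewrite [LHS](tliftE _ _ Fb) qdot_mul exchange_tlift sw_pair //.
by apply: eq_tlift => m1 m2; apply: eq_tlift => l1 l2; rewrite bcolE bdotE.
Qed.

Lemma bcol_mul (h : H) (c : C) :
  \sw_(a, b <- c) qcol B ((h * X b) \ox U a) =
  \sw_(a, b <- c) qcol B (h \ox D b) * P a.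
Proof.
have Fb : bilin (fun u x : H => qcol B ((h * x) \ox u)) by mlin.
have Gb : bilin (fun p d : H => qcol B (h \ox d) * p) by mlin.
transitivity (tlift (fun u x : H => qcol B ((h * x) \ox u)) (c : H \ox H)).
  by rewrite -(sw_bfst_bsnd c Fb) (sw_cocommuting c bfst_bsndC Fb).
rewrite (sw_cocommuting c bcol_bdotC Gb).
have Gb' : bilin (fun a b => qcol B (h \ox D a) * P b).
  exact: bilin_compC Gb Pl Dl.
move: c; apply: tensor_ext => [||l m].
- exact: tlift_linear Fb.
- exact: linear_tlift_arg Gb' (@comul_linear _ _).
rewrite [LHS](tliftE _ _ Fb) qcol_mul sw_pair //.
by apply: eq_tlift => l1 l2; apply: eq_tlift => m1 m2; rewrite bcolE bdotE.
Qed.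

Lemma bdot_antipode (c : C) :
  \sw_(a, b <- c) qdot B (S (D a) \ox S (P b)) = S (U c).
Proof.
exact: (antipode_action_antipode bdot_morph bfst_morph bcol_antimorph
  bsnd_antimorph (@qdotM _ _ B) (@qdot1 _ _ B) bdot1l bdot_mul).
Qed.

(** The mirror image of bdot_antipode, obtained on the co-opposite coalgebra,
    where the Sweedler factors appear in the other order. *)
Lemma bcol_antipode (c : C) :
  \sw_(a, b <- c) qcol B (S (P b) \ox S (D a)) = S (X c).
Proof.
have mul' h (d : C^cop) : tlift (fun a b => qcol B ((h * X a) \ox U b)) (comul d) =
    tlift (fun a b => qcol B (h \ox D a) * P b) (comul d).
  rewrite !sw_cop; [exact: bcol_mul|by mlin|by mlin].
have := @antipode_action_antipode k C^cop H P D X U (qcol B)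
  (coalg_morphism_cop bcol_antimorph) (coalg_morphism_cop bsnd_antimorph)
  (coalg_antimorphism_cop bdot_morph) (coalg_antimorphism_cop bfst_morph)
  (@qcolM _ _ B) (@qcol1 _ _ B) bcol1l mul' c.
rewrite sw_cop //; mlin.
Qed.
End Brace.

(** * The braiding is a coalgebra morphism *)
Section Braiding.
Variables (k : fieldType) (H : hopfAlgType k) (B : hopfQBrace H).
Local Notation C := (H \ox H^cop)%type.
Local Notation S := (@antipode k H).
Local Notation D := (bdot B).
Local Notation P := (bcol B).
Local Notation U := (@bfst k H).
Local Notation X := (@bsnd k H).

Let Dl : linear D. Proof. by case: (bdot_morph B). Qed.
Let Pl : linear P. Proof. by case: (bcol_antimorph B). Qed.
Let Ul : linear U. Proof. by case: (bfst_morph H). Qed.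
Let Xl : linear X. Proof. by case: (bsnd_antimorph H). Qed.

Definition bgbar (c : C) : H \ox H := gbar (qdot B) (c : H \ox H).

Let Gl : linear bgbar. Proof. exact: tlift_linear (gbar_bilin B). Qed.

Lemma bgbarE (c : C) : bgbar c = \sw_(a, b <- c) D b \ox X a.
Proof.
have Fb := bilin_compC (tens_bilin H H) Dl Xl.
suff E (x y : H) : bgbar (x \ox y : C) = \sw_(a, b <- (x \ox y : C)) D b \ox X a.
  move: c; apply: tensor_ext => [||x y]; [exact: Gl| |exact: E].
  exact: linear_tlift_arg Fb (@comul_linear _ _).
rewrite sw_pair // [LHS]gbarE.
rewrite -[LHS](sw_counitl (F := fun x => \sw_(y1, y2 <- y) qdot B (x \ox y1) \ox y2));
  last exact: (gbar_bilin B).1.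
apply: eq_tlift => x1 x2.
rewrite (linear_tlift _ _ (@linear_scale_fun _ _ _ (counit x1) id (@linear_idfun _ _))).
apply: eq_tlift => y1 y2.
by rewrite bdotE bsndE (lin_scale ((tens_bilin _ _).2 _)).
Qed.

Lemma gbar_ext (Y : lmodType k) (f g : H \ox H -> Y) :
  (forall c : C, f (bgbar c) = g (bgbar c)) -> f =1 g.
Proof. by move=> fg z; have := fg (gbar_inv B z); rewrite /bgbar gbar_invK. Qed.

Definition lact_tens : H \ox H -> H := tlift (lact B).
Definition ract_tens : H \ox H -> H := tlift (ract B).

Let ll : linear lact_tens. Proof. exact: tlift_linear (lact_bilin B). Qed.
Let rl : linear ract_tens. Proof. exact: tlift_linear (ract_bilin B). Qed.

Lemma ract_tens_gbar (c : C) : ract_tens (bgbar c) = U c.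
Proof.
have E z : ract_tens z = tprojl (gbar_inv B z).
  move: z; apply: tensor_ext => [||x y]; [exact: rl| |].
    exact: linear_comp (@tprojl_linear _ _ _) (gbar_inv_linear B).
  by rewrite /ract_tens tliftE //; exact: ract_bilin.
rewrite E /bgbar gbarK; move: c; apply: tensor_ext => [||x y]; [|exact: Ul|].
  exact: (@tprojl_linear k H H).
by rewrite [LHS]tprojlE bfstE.
Qed.

Let braidl : linear (braid B). Proof. exact: tlift_linear (braid_bilin B). Qed.

Lemma braid_act (z : H \ox H) : braid B z = \sw_(u, v <- z) lact_tens v \ox ract_tens u.
Proof.
have Fb := bilin_compC (tens_bilin H H) ll rl.
move: z; apply: tensor_ext => [||x y]; [exact: braidl| |].
  exact: linear_tlift_arg Fb (@comul_linear _ _).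
rewrite braidE [RHS](tlift_tens_comul (F := fun u v => lact_tens v \ox ract_tens u)) //.
apply: eq_tlift => x1 x2; apply: eq_tlift => y1 y2.
rewrite /lact_tens /ract_tens !tliftE //; [exact: ract_bilin|exact: lact_bilin].
Qed.

(** The coproduct of gbar c, computed from D c2 (x) X c1: D and X split into
    four factors X c1, X c2, D c3, D c4, of which the middle two recombine into
    gbar. *)
Lemma sw_gbar (W : lmodType k) (F : H \ox H -> H \ox H -> W) (c : C) :
  bilin F ->
  \sw_(u, v <- bgbar c) F u v =
  \sw_(a, r <- c) \sw_(m, b <- r) F (bgbar m) (D b \ox X a).
Proof.
move=> Fb; have [F1 F2] := Fb.
transitivity (\sw_(a, b <- c) \sw_(a1, a2 <- a) \sw_(b1, b2 <- b)
    F (D b1 \ox X a2) (D b2 \ox X a1)).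
  rewrite bgbarE (linear_tlift _ _ (@comul_linear _ _)).
  rewrite (linear_tlift _ _ (tlift_linear Fb)); apply: eq_tlift => a b.
  rewrite tlift_tens_comul // exchange_tlift.
  rewrite (sw_anticoalg (F := fun s t => \sw_(p, q <- D b) F (p \ox s) (q \ox t))
     _ (bsnd_antimorph H)); last first.
    split=> u; apply: linear_tlift_fun => p q.
      by apply: (linear_comp (F1 _)); mlin.
    by apply: (linear_comp (F2 _)); mlin.
  apply: eq_tlift => a1 a2.
  rewrite (sw_coalg (F := fun p q => F (p \ox X a2) (q \ox X a1))
    _ (bdot_morph B)) //.
  split=> u; first by apply: (linear_comp (F1 _)); mlin.
  by apply: (linear_comp (F2 _)); mlin.
rewrite (sweedlerA (F := fun a1 a2 b => \sw_(b1, b2 <- b)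
    F (D b1 \ox X a2) (D b2 \ox X a1))).
- apply: eq_tlift => a r.
  rewrite (sw_merge (K := fun m b => F (bgbar m) (D b \ox X a))) //.
  + move=> b1 b2; apply: (linear_comp (F1 _)); mlin.
  + move=> a2 b2; apply: (linear_comp (F1 _)); mlin.
  + move=> a2 b1; apply: (linear_comp (F2 _)); mlin.
  by move=> m b; rewrite bgbarE (linear_tlift _ _ (F1 _)).
- move=> a2 b; apply: linear_tlift_fun => b1 b2.
  by apply: (linear_comp (F2 _)); mlin.
- move=> a1 b; apply: linear_tlift_fun => b1 b2.
  by apply: (linear_comp (F1 _)); mlin.
move=> a1 a2; apply: linear_tlift_arg; last exact: comul_linear.
split=> u; first by apply: (linear_comp (F1 _)); mlin.
by apply: (linear_comp (F2 _)); mlin.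
Qed.

Lemma lact_tensE x y :
  lact_tens (x \ox y) = \sw_(y1, y2 <- y) qcol B (y2 \ox ract_tens (x \ox y1)).
Proof.
rewrite [LHS](tliftE _ _ (lact_bilin B)); apply: eq_tlift => y1 y2.
by rewrite /ract_tens tliftE //; exact: ract_bilin.
Qed.

(** The factor X c1 splits in reverse order, which leaves D c3 (x) X c2 under
    the right action; this is gbar, on which the right action is U. *)
Lemma lact_tens_gbar (c : C) : lact_tens (bgbar c) = P c.
Proof.
transitivity (\sw_(a, r <- c) \sw_(b, d <- r)
    qcol B (X a \ox ract_tens (D d \ox X b))).
  rewrite -(sweedlerA (F := fun a b d => qcol B (X a \ox ract_tens (D d \ox X b))));
    try by mlin.
  rewrite bgbarE (linear_tlift _ _ ll); apply: eq_tlift => a b.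
  rewrite lact_tensE.
  rewrite (sw_anticoalg (F := fun s t => qcol B (t \ox ract_tens (D b \ox s)))
     _ (bsnd_antimorph H)) //; mlin.
transitivity (\sw_(a, r <- c) qcol B (X a \ox U r)).
  apply: eq_tlift => a r.
  have Kl : linear (fun z => qcol B (X a \ox ract_tens z)) by mlin.
  by rewrite -ract_tens_gbar bgbarE (linear_tlift _ _ Kl).
have Fb : bilin (fun u x : H => qcol B (x \ox u)) by mlin.
rewrite -(sw_cocommuting c (@bfst_bsndC k H) Fb) (sw_bfst_bsnd c Fb).
by rewrite /bcol (linear_tlift _ _ (linearP (qcol B))).
Qed.

(** The actions give lact (D c3 (x) X c1) (x) U c2; exchanging U and X brings
    D and X next to each other, so that they recombine into gbar. *)
Lemma braid_gbar (c : C) : braid B (bgbar c) = \sw_(a, b <- c) P b \ox U a.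
Proof.
rewrite braid_act (sw_gbar _ (F := fun u v => lact_tens v \ox ract_tens u)); last by mlin.
transitivity (\sw_(a, r <- c) \sw_(b, d <- r) lact_tens (D d \ox X a) \ox U b).
  apply: eq_tlift => a r; apply: eq_tlift => b d; by rewrite ract_tens_gbar.
transitivity (\sw_(a, r <- c) \sw_(b, d <- r) lact_tens (D d \ox X b) \ox U a).
  apply/esym/(@sw_cocommuting12 _ _ _ _ _ U X
    (fun u x d => lact_tens (D d \ox x) \ox u) c (@bfst_bsndC k H)) => //; by mlin.
apply: eq_tlift => a r.
have Kl : linear (fun z => lact_tens z \ox U a) by mlin.
by rewrite -(linear_tlift (fun b d => D d \ox X b) _ Kl) -bgbarE lact_tens_gbar.
Qed.

(** Both sides are brought to the form (P c3 (x) U c1) (x) braid (gbar c2).  On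
    the right this takes one exchange of P with D and one of U with X. *)
Lemma braid_comul_gbar (c : C) :
  comul (braid B (bgbar c)) =
  \sw_(u, v <- bgbar c) braid B u \ox braid B v.
Proof.
transitivity (\sw_(a, r <- c) \sw_(m, b <- r) (P b \ox U a) \ox braid B (bgbar m)).
  transitivity (\sw_(a, b <- c) \sw_(a1, a2 <- a) \sw_(b1, b2 <- b)
      (P b2 \ox U a1) \ox (P b1 \ox U a2)).
    rewrite braid_gbar (linear_tlift _ _ (@comul_linear _ _)).
    apply: eq_tlift => a b; rewrite [LHS]tens_comulE exchange_tlift.
    rewrite (sw_coalg (F := fun s t => \sw_(p, q <- P b) (p \ox s) \ox (q \ox t))
      _ (bfst_morph H)); last by mlin.
    apply: eq_tlift => a1 a2.
    by rewrite (sw_anticoalg (F := fun p q => (p \ox U a1) \ox (q \ox U a2))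
      _ (bcol_antimorph B)) //; mlin.
  rewrite (sweedlerA (F := fun a1 a2 b => \sw_(b1, b2 <- b)
    (P b2 \ox U a1) \ox (P b1 \ox U a2))); [|by mlin..].
  apply: eq_tlift => a r.
  rewrite (sw_merge (K := fun m b => (P b \ox U a) \ox braid B (bgbar m)));
    [by []|by mlin..|].
  move=> m b; rewrite braid_gbar.
  by rewrite (linear_tlift _ _ ((tens_bilin _ _).2 _)).
rewrite (sw_gbar _ (F := fun u v => braid B u \ox braid B v)); last by mlin.
transitivity (\sw_(a, r <- c) \sw_(e, r' <- r) \sw_(f, b <- r')
    (P b \ox U e) \ox braid B (D f \ox X a)); last first.
  apply: eq_tlift => a r.
  transitivity (\sw_(e, r' <- r) \sw_(f, b <- r')
      (P f \ox U e) \ox braid B (D b \ox X a)).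
    apply: eq_tlift => e r'; apply/esym/(sw_cocommuting (F := fun p d =>
      (p \ox U e) \ox braid B (d \ox X a)) _ (@bcol_bdotC k H B)).
    by mlin.
  rewrite -(sweedlerA (F := fun e f b =>
    (P f \ox U e) \ox braid B (D b \ox X a))); [|by mlin..].
  apply: eq_tlift => m b; rewrite braid_gbar.
  by rewrite (linear_tlift _ _ ((tens_bilin _ _).1 _)).
transitivity (\sw_(a, r <- c) \sw_(e, r' <- r) \sw_(f, b <- r')
    (P b \ox U a) \ox braid B (D f \ox X e)); last first.
  apply: (@sw_cocommuting12 _ _ _ _ _ U X (fun u x r' => \sw_(f, b <- r')
    (P b \ox u) \ox braid B (D f \ox x)) c (@bfst_bsndC k H)) => //; by mlin.
apply: eq_tlift => a r.
rewrite -(sweedlerA (F := fun e f b =>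
    (P b \ox U a) \ox braid B (D f \ox X e))); [|by mlin..].
apply: eq_tlift => m b.
have Kl : linear (fun z => (P b \ox U a) \ox braid B z) by mlin.
by rewrite bgbarE (linear_tlift _ _ Kl).
Qed.

Lemma braid_coalg : coalg_morphism (braid B).
Proof.
apply: coalg_morphismP => //.
  apply: (@gbar_ext k^o) => c.
  rewrite braid_gbar bgbarE.
  have [_ De _] := bdot_morph B; have [_ Pe _] := bcol_antimorph B.
  have [_ Ue _] := bfst_morph H; have [_ Xe _] := bsnd_antimorph H.
  by rewrite !counit_sw_tens.
apply: gbar_ext; exact: braid_comul_gbar.
Qed.
End Braiding.

(** * Bijectivity of the braiding, and its value on antipodes *)
Section BraidInverse.
Variables (k : fieldType) (H : hopfAlgType k) (B : hopfQBrace H).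
Local Notation S := (@antipode k H).

Lemma braid_gbar_tens (x y : H) : braid B (gbar (qdot B) (x \ox y)) =
  \sw_(x1, x2 <- x) qcol B (y \ox x2) \ox x1.
Proof.
have [Ul _ _] := bfst_morph H; have [Pl _ _] := bcol_antimorph B.
rewrite [LHS](braid_gbar B (x \ox y)) sw_pair; last by mlin.
apply: eq_tlift => x1 x2.
rewrite -(sw_counitr (F := fun y => qcol B (y \ox x2) \ox x1)); last by mlin.
apply: eq_tlift => y1 y2.
by rewrite bcolE bfstE (lin_scale ((tens_bilin _ _).2 _)).
Qed.

(** The composite of the braiding with gbar; unlike the braiding itself it is
    given by a closed formula. *)
Definition colmap : H \ox H -> H \ox H :=
  tlift (fun x y => \sw_(x1, x2 <- x) qcol B (y \ox x2) \ox x1).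

Definition colmap_inv : H \ox H -> H \ox H :=
  tlift (fun z x => \sw_(x1, x2 <- x) x1 \ox qcol B (z \ox S x2)).

Lemma colmap_linear : linear colmap.
Proof. by apply: tlift_linear; mlin. Qed.

Lemma colmap_inv_linear : linear colmap_inv.
Proof. by apply: tlift_linear; mlin. Qed.

Lemma colmapE x y :
  colmap (x \ox y) = \sw_(x1, x2 <- x) qcol B (y \ox x2) \ox x1.
Proof. by apply: (tliftE (f := fun x y => _)); mlin. Qed.

Lemma colmap_invE z x :
  colmap_inv (z \ox x) = \sw_(x1, x2 <- x) x1 \ox qcol B (z \ox S x2).
Proof. by apply: (tliftE (f := fun z x => _)); mlin. Qed.

Lemma colmapK : cancel colmap colmap_inv.
Proof.
have ql := colmap_linear; have rl := colmap_inv_linear.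
apply: tensor_ext => [||x y]; [by mlin|by []|].
transitivity (\sw_(a, r <- x) \sw_(b, d <- r) a \ox qcol B (y \ox (S b * d))).
  rewrite -(sweedlerA (F := fun a b d => a \ox qcol B (y \ox (S b * d))));
    [|by mlin..].
  rewrite colmapE (linear_tlift _ _ rl); apply: eq_tlift => x1 x2.
  by rewrite colmap_invE; apply: eq_tlift => a b; rewrite qcolM.
transitivity (\sw_(a, r <- x) counit r *: (a \ox y)).
  apply: eq_tlift => a r.
  have Kl : linear (fun z => a \ox qcol B (y \ox z)) by mlin.
  by rewrite -(linear_tlift (fun b d => S b * d) _ Kl) antipodel (lin_scale Kl) qcol1.
by rewrite (sw_counitr (F := fun a => a \ox y)) //; mlin.
Qed.

Lemma colmap_invK : cancel colmap_inv colmap.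
Proof.
have ql := colmap_linear; have rl := colmap_inv_linear.
apply: tensor_ext => [||z x]; [by mlin|by []|].
transitivity (\sw_(a, r <- x) \sw_(b, d <- r) qcol B (z \ox (b * S d)) \ox a).
  rewrite -(sweedlerA (F := fun a b d => qcol B (z \ox (b * S d)) \ox a));
    [|by mlin..].
  rewrite colmap_invE (linear_tlift _ _ ql); apply: eq_tlift => x1 x2.
  by rewrite colmapE; apply: eq_tlift => a b; rewrite qcolM.
transitivity (\sw_(a, r <- x) counit r *: (z \ox a)).
  apply: eq_tlift => a r.
  have Kl : linear (fun y => qcol B (z \ox y) \ox a) by mlin.
  by rewrite -(linear_tlift (fun b d => b * S d) _ Kl) antipoder (lin_scale Kl) qcol1.
by rewrite (sw_counitr (F := fun a => z \ox a)) //; mlin.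
Qed.

Lemma braid_gbarE (z : H \ox H) : braid B (gbar (qdot B) z) = colmap z.
Proof.
have gl := tlift_linear (gbar_bilin B); have bl := tlift_linear (braid_bilin B).
move: z; apply: tensor_ext => [||x y].
- exact: (linear_comp bl gl).
- exact: colmap_linear.
by rewrite braid_gbar_tens colmapE.
Qed.

Definition braid_inv (z : H \ox H) : H \ox H := gbar (qdot B) (colmap_inv z).

Lemma braidK : cancel (braid B) braid_inv.
Proof.
move=> z; rewrite -[z in LHS](gbar_invK B) /braid_inv braid_gbarE colmapK.
exact: gbar_invK.
Qed.

Lemma braid_invK : cancel braid_inv (braid B).
Proof. by move=> z; rewrite /braid_inv braid_gbarE colmap_invK. Qed.

(** The preimage under gbar of S (U c1) (x) S (P c2) is S (D c1) (x) S (P c2), by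
    bdot_antipode.  Applying colmap to it gives S (P c3) : S (D c1) (x) S (D c2);
    after exchanging P with D, bcol_antipode applies to the first factor. *)
Lemma braid_antipode (c : H \ox H^cop) :
  braid B (\sw_(a, b <- c) S (bfst a) \ox S (bcol B b)) =
  \sw_(a, b <- c) S (bsnd a) \ox S (bdot B b).
Proof.
have [Dl _ _] := bdot_morph B; have [Pl _ _] := bcol_antimorph B.
have [Ul _ _] := bfst_morph H; have [Xl _ _] := bsnd_antimorph H.
have Sm := antipode_antimorph H.
have bl : linear (braid B) := tlift_linear (braid_bilin B).
have gl : linear (gbar (qdot B)) := tlift_linear (gbar_bilin B).
set lhs := (X in braid B X = _).
have -> : lhs = gbar (qdot B) (\sw_(a, b <- c) S (bdot B a) \ox S (bcol B b)).
  rewrite (linear_tlift _ _ gl) /lhs.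
  transitivity (\sw_(a, r <- c) \sw_(b, d <- r)
      qdot B (S (bdot B a) \ox S (bcol B b)) \ox S (bcol B d)).
    rewrite (sw_merge (K := fun m d => S (bfst m) \ox S (bcol B d)));
      [by []|by mlin..|].
    move=> m d; rewrite -(bdot_antipode B).
    by rewrite (linear_tlift _ _ ((tens_bilin _ _).1 _)).
  apply: eq_tlift => a b; rewrite gbarE.
  rewrite (sw_anticoalg (F := fun p q => qdot B (S (bdot B a) \ox p) \ox q) _ Sm);
    last by mlin.
  rewrite (sw_anticoalg (F := fun p q => qdot B (S (bdot B a) \ox S q) \ox S p)
    _ (bcol_antimorph B)) //; by mlin.
rewrite braid_gbarE (linear_tlift _ _ colmap_linear).
transitivity (\sw_(a, r <- c) \sw_(b, d <- r)
   qcol B (S (bcol B d) \ox S (bdot B a)) \ox S (bdot B b)).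
  rewrite -(sweedlerA (F := fun a b d =>
    qcol B (S (bcol B d) \ox S (bdot B a)) \ox S (bdot B b))); [|by mlin..].
  apply: eq_tlift => a b; rewrite colmapE.
  rewrite (sw_anticoalg (F := fun p q => qcol B (S (bcol B b) \ox q) \ox p) _ Sm);
    last by mlin.
  rewrite (sw_coalg (F := fun p q => qcol B (S (bcol B b) \ox S p) \ox S q)
    _ (bdot_morph B)) //; by mlin.
transitivity (\sw_(a, r <- c) \sw_(b, d <- r)
   qcol B (S (bcol B b) \ox S (bdot B a)) \ox S (bdot B d)).
  apply: eq_tlift => a r; apply/esym.
  apply: (sw_cocommuting (F := fun p d =>
    qcol B (S p \ox S (bdot B a)) \ox S d) _ (@bcol_bdotC k H B)); by mlin.
rewrite (sw_merge (K := fun m d => S (bsnd m) \ox S (bdot B d)));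
  [by []|by mlin..|].
move=> m d; rewrite -(bcol_antipode B).
by rewrite (linear_tlift _ _ ((tens_bilin _ _).1 _)).
Qed.

End BraidInverse.

(** * Conjugation by the flip *)
Section Flip.
Variable k : fieldType.

Lemma tswapE (U V : lmodType k) (u : U) (v : V) : tswap (u \ox v) = v \ox u.
Proof. by apply: (tliftE (f := fun u v => _)); mlin. Qed.

Lemma tswapK (U V : lmodType k) : cancel (@tswap k U V) (@tswap k V U).
Proof.
apply: tensor_ext => [||u v]; [|by []|by rewrite !tswapE].
exact: linear_comp (@tswap_linear k V U) (@tswap_linear k U V).
Qed.

Lemma tmap_coalg (C D C' D' : coalgType k) (f : C -> C') (g : D -> D') :
  coalg_morphism f -> coalg_morphism g -> coalg_morphism (tmap f g).
Proof.
move=> fm gm; have [fl fe _] := fm; have [gl ge _] := gm.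
have fgb : bilin (fun u v => f u \ox g v) by mlin.
have fgl : linear (tmap f g) := tlift_linear fgb.
apply: coalg_morphismP => //.
  apply: (@tensor_ext _ _ _ k^o (fun z => counit (tmap f g z)) counit).
  - by move=> a x y; rewrite fgl counit_scalar.
  - exact: (@counit_scalar k (C \ox D)%type).
  by move=> u v; rewrite /tmap tliftE // !counit_tens fe ge.
apply: tensor_ext => [||u v]; [by mlin|by mlin|].
rewrite [tmap f g _](tliftE u v fgb) [LHS]tens_comulE.
rewrite (tlift_tens_comul (F := fun a b => tmap f g a \ox tmap f g b)); last by mlin.
rewrite (sw_coalg (F := fun c1 c2 => \sw_(d1, d2 <- g v)
  (c1 \ox d1) \ox (c2 \ox d2)) u fm); last by mlin.
apply: eq_tlift => u1 u2.
rewrite (sw_coalg (F := fun d1 d2 => (f u1 \ox d1) \ox (f u2 \ox d2)) v gm);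
  last by mlin.
by apply: eq_tlift => v1 v2; rewrite /tmap !tliftE.
Qed.

(** The flip of C (x) C preserves the comultiplication; passing to the
    co-opposite on both factors of the source reverses it. *)
Lemma tswap_coalg (C : coalgType k) :
  coalg_antimorphism (C := (C^cop \ox C^cop)%type) (D := (C \ox C)%type)
    (@tswap k C C).
Proof.
have sl := @tswap_linear k C C.
split=> [||z]; first exact: sl.
  apply: (@tensor_ext _ _ _ k^o (fun z => counit (tswap z)) counit).
  - by move=> a x y; rewrite sl counit_scalar.
  - exact: (@counit_scalar k (C^cop \ox C^cop)%type).
  by move=> u v; rewrite tswapE counit_tens mulrC [RHS]counit_tens.
pose F (a b : C^cop \ox C^cop) : (C \ox C) \ox (C \ox C) := tswap b \ox tswap a.
have Fb : bilin F := bilin_compC (tens_bilin _ _) sl sl.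
have [F1 F2] := Fb.
suff E (u v : C) : comul (v \ox u) =
    tlift F (@comul k (C^cop \ox C^cop)%type (u \ox v)).
  move: z; apply: tensor_ext => [||u v]; last by rewrite tswapE; exact: E.
    exact: linear_comp (@comul_linear _ _) sl.
  exact: linear_tlift_arg Fb (@comul_linear _ _).
rewrite [RHS](@tlift_tens_comul k C^cop C^cop _ F u v Fb).
rewrite [RHS](@sw_cop k C _ (fun u1 u2 => tlift (fun v1 v2 : C =>
  F (u1 \ox v1) (u2 \ox v2)) (@comul k C^cop v))); last first.
  split=> x; apply: linear_tlift_fun => v1 v2.
    by apply: (linear_comp (F1 _)); apply: linear_tensl.
  by apply: (linear_comp (F2 _)); apply: linear_tensl.
rewrite [LHS]tens_comulE exchange_tlift; apply: eq_tlift => u1 u2.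
rewrite [RHS](@sw_cop k C _ (fun v1 v2 => F (u2 \ox v1) (u1 \ox v2))).
  by apply: eq_tlift => v1 v2; rewrite /F !tswapE.
split=> x; first by apply: (linear_comp (F1 _)); apply: linear_tensr.
by apply: (linear_comp (F2 _)); apply: linear_tensr.
Qed.
End Flip.

Theorem proposition5p33 (k : fieldType) (H : hopfAlgType k)
    (B : hopfQBrace H) :
  let SS : H^cop \ox H^cop -> H \ox H :=
    tmap (antipode : H^cop -> H) (antipode : H^cop -> H) in
  bijective (braid B) /\
  exists t : H^cop \ox H^cop -> H^cop \ox H^cop,
    (cancel (braid_tau B) t /\ cancel t (braid_tau B)) /\
    [/\ coalg_morphism t,
        coalg_morphism (braid B),
        coalg_morphism SS
      & forall z : H^cop \ox H^cop, SS (t z) = braid B (SS z)].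
Proof.
move=> SS.
have SSb : bilin (fun u v : H => antipode u \ox antipode v) by mlin.
split; first by exists (braid_inv B); [exact: braidK|exact: braid_invK].
pose t (z : H^cop \ox H^cop) : H^cop \ox H^cop := tswap (braid_inv B (tswap z)).
have tK : cancel (braid_tau B) t.
  by move=> z; rewrite /t /braid_tau tswapK braidK tswapK.
have Kt : cancel t (braid_tau B).
  by move=> z; rewrite /t /braid_tau tswapK braid_invK tswapK.
have Sm : @coalg_morphism k H^cop H (antipode : H -> H).
  exact: coalg_morphism_cop (antipode_antimorph H).
exists t; split=> //; split.
- apply: coalg_morphism_inv tK Kt _.
  have bm := coalg_morphism_copcop (braid_coalg B).
  have sm : @coalg_morphism k (H^cop \ox H^cop)%type (H \ox H)^cop (@tswap k H H).
    exact: coalg_morphism_codom (tswap_coalg H).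
  have sm' : @coalg_morphism k (H \ox H)^cop (H^cop \ox H^cop)%type (@tswap k H H).
    exact: (@coalg_morphism_inv k (H^cop \ox H^cop)%type (H \ox H)^cop
      (@tswap k H H) (@tswap k H H) (@tswapK k H H) (@tswapK k H H) sm).
  exact: coalg_morphism_comp sm' (coalg_morphism_comp bm sm).
- exact: braid_coalg.
- exact: tmap_coalg.
move=> z; rewrite -[z in RHS]Kt; move: (t z) => w {z}.
have [Dl _ _] := bdot_morph B; have [Pl _ _] := bcol_antimorph B.
have [Ul _ _] := bfst_morph H; have [Xl _ _] := bsnd_antimorph H.
have SSl : linear (tlift (fun u v : H => antipode u \ox antipode v)) :=
  tlift_linear SSb.
have SSE (f g : H \ox H^cop -> H) c :
    SS (tswap (\sw_(a, b <- c) f b \ox g a)) =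
    \sw_(a, b <- c) antipode (g a) \ox antipode (f b).
  rewrite (linear_tlift _ _ (@tswap_linear k H H)) [LHS](linear_tlift _ _ SSl).
  by apply: eq_tlift => a b; rewrite tswapE [LHS](tliftE _ _ SSb).
(* Every tensor is, up to the flip, a value of gbar, where both sides are
   Sweedler sums over the same c. *)
pose c : H \ox H^cop := gbar_inv B (tswap w).
have Ew : tswap w = bgbar B c by rewrite /bgbar gbar_invK.
rewrite /braid_tau Ew braid_gbar SSE braid_antipode -SSE -bgbarE -Ew.
by rewrite tswapK.
Qed.
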